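(* Let $N\ge1$, $d>1$, and let $L=\mathrm{diag}(L^1,\dots,L^d)$ and $f$ satisfy the standing assumptions (C), (N1)-(N4) listed in the context. Assume $\lambda_1^p\ge0$. Suppose that $$\forall(x,u)\in\mathbb{T}^N\times[0,\infty)^d,\quad f(x,u)\le D_uf(x,\mathbf{0})u,$$ and that this inequality is strict whenever $u\gg\mathbf{0}$, i.e. $$\forall(x,u)\in\mathbb{T}^N\times(0,\infty)^d,\quad f(x,u)<D_uf(x,\mathbf{0})u .$$ Then, for every direction $e\in\mathbb{S}^{N-1}$ (and every speed $c\ne0$), there exists no pulsating travelling wave of $$\partial_t u+Lu=f(x,u),\qquad (t,x)\in\mathbb{R}\times\mathbb{R}^N,$$ in the direction $e$ with speed $c$.
   Context: Notation. $\mathbb{T}^N=(\mathbb{R}/\mathbb{Z})^N$; functions on $\mathbb{T}^N$ are identified with $\mathbb{Z}^N$-periodic functions on $\mathbb{R}^N$. $\mathbb{S}^{N-1}$ is the Euclidean unit sphere of $\mathbb{R}^N$. For $u,v\in\mathbb{R}^d$: $u\le v$ means $u_i\le v_i$ for all $i$; $u\ll v$ means $u_i<v_i$ for all $i$; $u<v$ means $u\le v$ and $u_i<v_i$ for some $i$. $|u|_\infty=\max_i|u_i|$, $\mathbf{1}=(1,\dots,1)^T$, $\mathbf{0}=(0,\dots,0)^T$, and $\|\phi\|_\infty=\max_i\sup|\phi_i|$. Operators. $L=\mathrm{diag}(L^1,\dots,L^d)$, where the $L^i$ are either in divergence form $L^i\psi=-\nabla\cdot(A^i(x)\nabla\psi)+q^i(x)\cdot\nabla\psi$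 or in nondivergence form $L^i\psi=-\mathrm{tr}(A^i(x)D^2\psi)+q^i(x)\cdot\nabla\psi$. (C) There is $\alpha>0$ such that each $A^i:\mathbb{T}^N\to\mathcal{S}_N(\mathbb{R})$ (real symmetric matrices) is of class $C^{1,\alpha}$, each $q^i:\mathbb{T}^N\to\mathbb{R}^N$ is of class $C^\alpha$, and there are constants $0<\underline\gamma\le\overline\gamma$ with $\underline\gamma|\xi|^2\le\xi^TA^i(x)\xi\le\overline\gamma|\xi|^2$ for all $x\in\mathbb{T}^N$, $\xi\in\mathbb{R}^N$, $i$. A matrix-valued function $H=(h_{ij})$ on a domain is cooperative if $h_{ij}(z)\ge0$ for all $z$ whenever $i\ne j$; it is fully coupled if for every partition of $\{1,\dots,d\}$ into two nonempty disjoint sets $I,J$ there are $i_0\in I$, $j_0\in J$ with $h_{i_0j_0}\not\equiv0$. (N1) $f:\mathbb{T}^N\times\mathbb{R}^d\to\mathbb{R}^d$ is continuous, of class $C^\alpha$ in $x$ locally uniformly in $u$; the partial derivatives $\partial f_i/\partial u_j$ exist and are continuous on $\mathbb{T}^N\times\mathbb{R}^d$; $f(x,\mathbf{0})\equiv\mathbf{0}$; and $f$ is of class $C^{1,\beta}$ on $\mathbb{T}^N\times\{|u|_\infty\le\sigma\}$ for some $\beta\in(0,1]$ and some small $\sigma>0$. (N2) The Jacobian $D_uf(x,u)$ is cooperative for all $(x,u)\in\mathbb{T}^N\times\Sigma$, for some set $\Sigma\subseteq\mathbb{R}^d$ with $[0,\infty)^d\subseteq\Sigma$. (N3) There is $\widehat\eta>0$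 such that $f(x,\widehat\eta\mathbf{1})\le\mathbf{0}$ for all $x\in\mathbb{T}^N$. (N4) For every $u\in\mathbb{R}^d$, the matrix field $x\mapsto D_uf(x,u)$ is fully coupled. Pulsating travelling wave in direction $e$ with speed $c\ne0$: a classical bounded entire solution $u$ of the system on $\mathbb{R}\times\mathbb{R}^N$, with $u\gg\mathbf{0}$ everywhere, such that $u(t+\frac{k\cdot e}{c},x)=u(t,x-k)$ for all $k\in\mathbb{Z}^N$, $(t,x)\in\mathbb{R}\times\mathbb{R}^N$, and $\liminf_{x\cdot e\to-\infty}u(t,x)\gg\mathbf{0}$, $\lim_{x\cdot e\to+\infty}u(t,x)=\mathbf{0}$, the limits being locally uniform in $t\in\mathbb{R}$ and uniform with respect to the vectors of $e^\perp=\{y\in\mathbb{R}^N: y\cdot e=0\}$. Principal eigenvalue. $\lambda_1^p$ is the periodic principal eigenvalue: the unique real number for which there is $\phi\in C^2(\mathbb{T}^N)^d$, $\phi\gg\mathbf{0}$, $\|\phi\|_\infty=1$, with $L\phi-D_uf(x,\mathbf{0})\phi=\lambda_1^p\phi$ in $\mathbb{T}^N$. *)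

(* Defs.v *)
From HB Require Import structures.
From mathcomp Require Import all_boot all_order all_algebra.
From mathcomp Require Import all_classical all_reals all_analysis.

Set Implicit Arguments.
Unset Strict Implicit.
Unset Printing Implicit Defensive.
Import Order.TTheory GRing.Theory Num.Theory.
Import numFieldNormedType.Exports.
Local Open Scope classical_set_scope.
Local Open Scope ring_scope.

(* Vectors are columns.  The library norm of a matrix is the maximum of the
   absolute values of its entries; the Euclidean structure is [dot]. *)

Definition dot (R : realType) (N : nat) (x y : 'cV[R]_N) : R :=
  (x^T *m y) 0 0.

Definition lev (R : realType) (d : nat) (u v : 'cV[R]_d) : Prop :=
  forall i, u i 0 <= v i 0.

Definition ltv (R : realType) (d : nat) (u v : 'cV[R]_d) : Prop :=
  lev u v /\ exists i, u i 0 < v i 0.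

Definition lltv (R : realType) (d : nat) (u v : 'cV[R]_d) : Prop :=
  forall i, u i 0 < v i 0.

(* Functions on the torus are Z^N-periodic functions on R^N. *)
Definition Zperiodic (R : realType) (N : nat) (W : zmodType)
    (g : 'cV[R]_N -> W) : Prop :=
  forall k : 'cV[int]_N, periodic g (map_mx intr k).

Definition partial (R : realType) (n : nat) (W : normedModType R) (k : 'I_n)
    (g : 'cV[R]_n -> W) (x : 'cV[R]_n) : W :=
  'D_(delta_mx k 0) g x.

Definition partial_exists (R : realType) (n : nat) (W : normedModType R)
    (k : 'I_n) (g : 'cV[R]_n -> W) (x : 'cV[R]_n) : Prop :=
  derivable g x (delta_mx k 0).

Definition holder_on (R : realType) (V W : normedModType R) (a C : R)
    (D : set V) (g : V -> W) : Prop :=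
  forall x y, D x -> D y -> `|g x - g y| <= C * `|x - y| `^ a.

(* No bound on g itself is imposed: these classes are only used for
   Z^N-periodic (hence bounded) functions. *)
Definition Calpha (R : realType) (N : nat) (W : normedModType R) (a : R)
    (g : 'cV[R]_N -> W) : Prop :=
  exists C, holder_on a C setT g.

Definition C1alpha (R : realType) (N : nat) (W : normedModType R) (a : R)
    (g : 'cV[R]_N -> W) : Prop :=
  forall k, (forall x, partial_exists k g x) /\ Calpha a (partial k g).

Definition C2 (R : realType) (N : nat) (W : normedModType R)
    (g : 'cV[R]_N -> W) : Prop :=
  [/\ continuous g,
      forall k x, partial_exists k g x,
      forall k, continuous (partial k g),
      forall k l x, partial_exists k (partial l g) x &
      forall k l, continuous (partial k (partial l g))].

Definition grad (R : realType) (N : nat) (psi : 'cV[R]_N -> R)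
    (x : 'cV[R]_N) : 'cV[R]_N :=
  \col_k partial k psi x.

Definition divergence (R : realType) (N : nat) (F : 'cV[R]_N -> 'cV[R]_N)
    (x : 'cV[R]_N) : R :=
  \sum_k partial k (fun y => F y k 0) x.

Definition hess (R : realType) (N : nat) (psi : 'cV[R]_N -> R)
    (x : 'cV[R]_N) : 'M[R]_N :=
  \matrix_(k, l) partial k (partial l psi) x.

Inductive op_form : Set := DivergenceForm | NondivergenceForm.

Definition scalar_op (R : realType) (N : nat) (form : op_form)
    (A : 'cV[R]_N -> 'M[R]_N) (q : 'cV[R]_N -> 'cV[R]_N)
    (psi : 'cV[R]_N -> R) (x : 'cV[R]_N) : R :=
  match form with
  | DivergenceForm => - divergence (fun y => A y *m grad psi y) x
  | NondivergenceForm => - \tr (A x *m hess psi x)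
  end + dot (q x) (grad psi x).

Definition diag_op (R : realType) (N d : nat) (form : 'I_d -> op_form)
    (A : 'I_d -> 'cV[R]_N -> 'M[R]_N) (q : 'I_d -> 'cV[R]_N -> 'cV[R]_N)
    (psi : 'cV[R]_N -> 'cV[R]_d) (x : 'cV[R]_N) : 'cV[R]_d :=
  \col_i scalar_op (form i) (A i) (q i) (fun y => psi y i 0) x.

Definition condC (R : realType) (N d : nat) (alpha : R)
    (A : 'I_d -> 'cV[R]_N -> 'M[R]_N)
    (q : 'I_d -> 'cV[R]_N -> 'cV[R]_N) : Prop :=
  [/\ forall i, [/\ Zperiodic (A i), forall x, (A i x)^T = A i x &
                    C1alpha alpha (A i)],
      forall i, Zperiodic (q i) /\ Calpha alpha (q i) &
      exists gmin gmax : R, [/\ 0 < gmin, gmin <= gmax &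
        forall i x xi,
          gmin * dot xi xi <= dot xi (A i x *m xi) <= gmax * dot xi xi]].

Definition Du (R : realType) (N d : nat)
    (f : 'cV[R]_N -> 'cV[R]_d -> 'cV[R]_d)
    (x : 'cV[R]_N) (u : 'cV[R]_d) : 'M[R]_d :=
  \matrix_(i, j) partial j (fun v => f x v i 0) u.

Definition cooperative_on (R : realType) (d : nat) (Z : Type) (D : set Z)
    (H : Z -> 'M[R]_d) : Prop :=
  forall z, D z -> forall i j, i != j -> 0 <= H z i j.

Definition fully_coupled (R : realType) (d : nat) (Z : Type)
    (H : Z -> 'M[R]_d) : Prop :=
  forall I J : {set 'I_d},
    I != finset.set0 -> J != finset.set0 ->
    I :&: J = finset.set0 -> I :|: J = finset.setT ->
    exists i j, [/\ i \in I, j \in J & exists z, H z i j != 0].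

(* Class C^{1,beta} jointly in (x, u) on T^N x {|u|_oo <= sigma}; the partial
   derivatives in u already exist everywhere by [condN1]. *)
Definition C1beta_near0 (R : realType) (N d : nat) (beta sigma : R)
    (f : 'cV[R]_N -> 'cV[R]_d -> 'cV[R]_d) : Prop :=
  let D := [set p : 'cV[R]_N * 'cV[R]_d | `|p.2| <= sigma] in
  (exists C, holder_on beta C D (fun p => Du f p.1 p.2)) /\
  (forall k, (forall x u, `|u| <= sigma -> partial_exists k (f ^~ u) x) /\
     exists C, holder_on beta C D (fun p => partial k (f ^~ p.2) p.1)).

Definition condN1 (R : realType) (N d : nat) (alpha : R)
    (f : 'cV[R]_N -> 'cV[R]_d -> 'cV[R]_d) : Prop :=
  [/\ forall u, Zperiodic (f ^~ u),
      continuous (fun p : 'cV[R]_N * 'cV[R]_d => f p.1 p.2) /\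
      (forall K : set 'cV[R]_d, compact K ->
        exists C, forall u, K u -> holder_on alpha C setT (f ^~ u)),
      (forall x u i j, partial_exists j (fun v => f x v i 0) u) /\
      continuous (fun p : 'cV[R]_N * 'cV[R]_d => Du f p.1 p.2),
      forall x, f x 0 = 0 &
      exists beta sigma : R,
        [/\ 0 < beta <= 1, 0 < sigma & C1beta_near0 beta sigma f]].

Definition condN2 (R : realType) (N d : nat)
    (f : 'cV[R]_N -> 'cV[R]_d -> 'cV[R]_d) : Prop :=
  exists Sigma : set 'cV[R]_d, [set u | lev 0 u] `<=` Sigma /\
    cooperative_on [set p : 'cV[R]_N * 'cV[R]_d | Sigma p.2]
      (fun p => Du f p.1 p.2).

Definition condN3 (R : realType) (N d : nat)
    (f : 'cV[R]_N -> 'cV[R]_d -> 'cV[R]_d) : Prop :=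
  exists2 eta : R, 0 < eta & forall x, lev (f x (const_mx eta)) 0.

Definition condN4 (R : realType) (N d : nat)
    (f : 'cV[R]_N -> 'cV[R]_d -> 'cV[R]_d) : Prop :=
  forall u, fully_coupled (fun x => Du f x u).

Definition vsupnorm (R : realType) (N d : nat)
    (phi : 'cV[R]_N -> 'cV[R]_d) : R :=
  \big[Num.max/0]_(i < d) sup (range (fun x => `|phi x i 0|)).

(* The relation "lambda is the periodic principal eigenvalue".  By the
   Krein-Rutman theory at most one real number satisfies it. *)
Definition periodic_principal_eigenvalue (R : realType) (N d : nat)
    (form : 'I_d -> op_form) (A : 'I_d -> 'cV[R]_N -> 'M[R]_N)
    (q : 'I_d -> 'cV[R]_N -> 'cV[R]_N)
    (f : 'cV[R]_N -> 'cV[R]_d -> 'cV[R]_d) (lambda : R) : Prop :=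
  exists phi : 'cV[R]_N -> 'cV[R]_d,
    [/\ Zperiodic phi, C2 phi, forall x, lltv 0 (phi x), vsupnorm phi = 1 &
        forall x, diag_op form A q phi x - Du f x 0 *m phi x
                  = lambda *: phi x].

(* u is of class C^1 in t and C^2 in x, with derivatives continuous in (t, x). *)
Definition C12 (R : realType) (N : nat) (W : normedModType R)
    (u : R -> 'cV[R]_N -> W) : Prop :=
  [/\ continuous (fun p : R * 'cV[R]_N => u p.1 p.2),
      (forall t x, derivable (u ^~ x) t 1) /\
      continuous (fun p : R * 'cV[R]_N => derive1 (u ^~ p.2) p.1),
      forall k, (forall t x, partial_exists k (u t) x) /\
        continuous (fun p : R * 'cV[R]_N => partial k (u p.1) p.2) &
      forall k l, (forall t x, partial_exists k (partial l (u t)) x) /\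
        continuous (fun p : R * 'cV[R]_N => partial k (partial l (u p.1)) p.2)].

Definition classical_bounded_entire_solution (R : realType) (N d : nat)
    (form : 'I_d -> op_form) (A : 'I_d -> 'cV[R]_N -> 'M[R]_N)
    (q : 'I_d -> 'cV[R]_N -> 'cV[R]_N)
    (f : 'cV[R]_N -> 'cV[R]_d -> 'cV[R]_d)
    (u : R -> 'cV[R]_N -> 'cV[R]_d) : Prop :=
  [/\ C12 u,
      exists M, forall t x, `|u t x| <= M &
      forall t x, derive1 (u ^~ x) t + diag_op form A q (u t) x = f x (u t x)].

(* The filter "x . e tends along G, uniformly in t in K and in the directions
   orthogonal to e": limits along it are uniform with respect to these. *)
Definition along (R : realType) (N : nat) (e : 'cV[R]_N) (K : set R)
    (G : set_system R) : set_system (R * 'cV[R]_N) :=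
  [set V | \forall s \near G,
     forall t x, K t -> dot x e = s -> V (t, x)].

Definition pulsating_wave (R : realType) (N d : nat)
    (form : 'I_d -> op_form) (A : 'I_d -> 'cV[R]_N -> 'M[R]_N)
    (q : 'I_d -> 'cV[R]_N -> 'cV[R]_N)
    (f : 'cV[R]_N -> 'cV[R]_d -> 'cV[R]_d)
    (e : 'cV[R]_N) (c : R) (u : R -> 'cV[R]_N -> 'cV[R]_d) : Prop :=
  [/\ classical_bounded_entire_solution form A q f u,
      forall t x, lltv 0 (u t x),
      forall (k : 'cV[int]_N) t x,
        u (t + dot (map_mx intr k) e / c) x = u t (x - map_mx intr k),
      forall K : set R, compact K -> forall i,
        (0 < limf_einf (fun p : R * 'cV[R]_N => (u p.1 p.2 i 0)%:E)
               (along e K (ninfty_nbhs R)))%E &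
      forall K : set R, compact K ->
        (fun p : R * 'cV[R]_N => u p.1 p.2) @ along e K (pinfty_nbhs R)
          --> (0 : 'cV[R]_d)].

(* Main.v *)
(* Let [phi] be the principal eigenfunction and [kap] the least number with
   [u <= kap * phi].  By the KPP inequality and [lambda1p >= 0] the difference
   [w = kap * phi - u >= 0] satisfies [w_t + L w >= D_u f(x, 0) w].  Comparing
   [w_i] with Gaussian bumps (Hopf's barrier) shows that a positive lower bound
   of [w_i], uniform in time, on one ball spreads to every ball, hence to all of
   space because the relation defining pulsating waves makes time-uniform bounds
   periodic in [x].  Such a bound propagates from [w_j] to [w_i] wherever
   [D_u f(x, 0)_ij > 0], hence to all components by full coupling; the strict
   KPP inequality at [kap * phi] starts the propagation.  So [w] is bounded away
   from zero, contradicting the minimality of [kap].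
   All lower bounds being uniform over the whole time line, no limit of time
   translates of [u] has to be taken. *)

Require Import Defs.
From mathcomp Require Import all_boot all_order all_algebra.
From mathcomp Require Import all_classical all_reals all_analysis.
From mathcomp Require Import ring lra.
Import Order.TTheory GRing.Theory Num.Theory.
Import numFieldNormedType.Exports.
Local Open Scope classical_set_scope.
Local Open Scope ring_scope.

Set Implicit Arguments.
Unset Strict Implicit.
Unset Printing Implicit Defensive.

(** * Positive definite matrices *)

Lemma dotE (R : realType) (n : nat) (x y : 'cV[R]_n) :
  dot x y = \sum_k x k 0 * y k 0.
Proof. by rewrite /dot mxE; apply: eq_bigr => k _; rewrite mxE. Qed.

Lemma quad_formE (R : realType) (n : nat) (M : 'M[R]_n) (x : 'cV[R]_n) :
  dot x (M *m x) = \sum_k \sum_l x k 0 * x l 0 * M k l.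
Proof.
rewrite dotE; apply: eq_bigr => k _; rewrite mxE big_distrr /=.
by apply: eq_bigr => l _; rewrite mulrA mulrAC.
Qed.

Lemma mxtrace_mulE (R : realType) (n : nat) (A M : 'M[R]_n) :
  \tr (A *m M) = \sum_k \sum_l A k l * M l k.
Proof. by rewrite /mxtrace; apply: eq_bigr => k _; rewrite mxE. Qed.

(* Induction on the size: [A = a^-1 (a, b)(a, b)^T + diag(0, D - a^-1 b b^T)],
   and the Schur complement of a positive definite matrix is positive
   definite. *)
Lemma mxtrace_mul_ge0 (R : realType) (n : nat) (A M : 'M[R]_n) :
  A^T = A -> (forall xi, xi != 0 -> 0 < dot xi (A *m xi)) ->
  (forall xi, 0 <= dot xi (M *m xi)) -> 0 <= \tr (A *m M).
Proof.
elim: n A M => [A M _ _ _|n IH A M symA posA posM].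
  by rewrite /mxtrace big_ord0.
pose a := A 0 0; pose b : 'cV[R]_n := \col_k A (lift 0 k) 0.
pose S : 'M[R]_n := \matrix_(k, l) (A (lift 0 k) (lift 0 l) - a^-1 * (b k 0 * b l 0)).
pose M' : 'M[R]_n := \matrix_(k, l) M (lift 0 k) (lift 0 l).
pose ext (t : R) (x : 'cV[R]_n) : 'cV[R]_n.+1 :=
  \col_k (if unlift 0 k is Some j then x j 0 else t).
have ext0 t x : ext t x 0 0 = t by rewrite mxE unlift_none.
have extl t x (k : 'I_n) : ext t x (lift 0 k) 0 = x k 0 by rewrite mxE liftK.
have symAE k l : A k l = A l k by rewrite -[in LHS]symA mxE.
have bE (k : 'I_n) : A (lift 0 k) 0 = b k 0 by rewrite mxE.
have Ab (k : 'I_n) : A 0 (lift 0 k) = b k 0 by rewrite mxE symAE.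
have a0 : 0 < a.
  have := posA (ext 1 0); rewrite quad_formE big_ord_recl [X in X + _]big_ord_recl !ext0.
  rewrite [X in _ + X + _]big1 => [|k _]; last by rewrite extl mxE mulr0 mul0r.
  rewrite [X in _ + X]big1 => [|k _]; last first.
    by rewrite big1 // => l _; rewrite extl mxE !mul0r.
  rewrite !addr0 !mul1r; apply; apply/eqP => /matrixP/(_ 0 0).
  by rewrite ext0 mxE => /eqP; rewrite oner_eq0.
(* Completing the square: the chosen first coordinate minimises the quadratic form of [A] over the
   extensions of [x], and the minimum is the form of the Schur complement [S]. *)
have quadS x : dot x (S *m x) = dot (ext (- (a^-1 * dot b x)) x)
    (A *m ext (- (a^-1 * dot b x)) x).
  set t := - _.
  rewrite !quad_formE big_ord_recl big_ord_recl !ext0 -/a.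
  under eq_bigr => k _ do under eq_bigr => l _ do
    rewrite mxE mulrBr.
  under [X in _ = _ + X]eq_bigr => k _.
    rewrite big_ord_recl ext0 extl bE.
    under eq_bigr => l _ do rewrite !extl.
    over.
  under [X in _ = _ + X + _]eq_bigr => l _ do rewrite extl Ab.
  rewrite big_split /=.
  under eq_bigr => k _ do rewrite big_split /=.
  rewrite big_split /= addrC addrA; congr (_ + _).
  have -> : \sum_(k < n) \sum_(l < n) - (x k 0 * x l 0 * (a^-1 * (b k 0 * b l 0)))
     = - (a^-1 * dot b x * dot b x).
    rewrite dotE [a^-1 * _]mulr_sumr big_distrlr /= -sumrN; apply: eq_bigr => k _.
    by rewrite -sumrN; apply: eq_bigr => l _; ring.
  have -> : \sum_(l < n) t * x l 0 * b l 0 = t * dot b x.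
    by rewrite dotE big_distrr; apply: eq_bigr => l _ /=; ring.
  have -> : \sum_(l < n) x l 0 * t * b l 0 = t * dot b x.
    by rewrite dotE big_distrr; apply: eq_bigr => l _ /=; ring.
  rewrite /t; field; rewrite gt_eqF //.
(* The rank-one part of [A] contributes the quadratic form of [M] at [(a, b)], up to the positive
   factor [a^-1]; the rest is a trace of smaller size. *)
have trE : \tr (A *m M) = a^-1 * dot (ext a b) (M *m ext a b) + \tr (S *m M').
  rewrite quad_formE !mxtrace_mulE.
  rewrite big_ord_recl big_ord_recl [in RHS]big_ord_recl [X in _ * (X + _)]big_ord_recl !ext0 -/a.
  under [X in _ + X = _]eq_bigr => k _ do rewrite big_ord_recl bE.
  under [X in _ * (_ + X) + _]eq_bigr => k _.
    rewrite big_ord_recl ext0 extl.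
    under eq_bigr => l _ do rewrite !extl.
    over.
  under [X in _ * (_ + X + _) + _]eq_bigr => k _ do rewrite extl.
  under [X in _ + X + _ = _]eq_bigr => k _ do rewrite Ab.
  under [X in _ = _ + X]eq_bigr => k _ do under eq_bigr => l _ do
    rewrite !mxE mulrBl.
  under [X in _ = _ + X]eq_bigr => k _ do rewrite big_split /=.
  rewrite !big_split /=.
  have -> : \sum_(k < n) \sum_(l < n) - (a^-1 * (A (lift 0 k) 0 * A (lift 0 l) 0) *
      M (lift 0 l) (lift 0 k)) =
      - (a^-1 * \sum_(k < n) \sum_(l < n) b k 0 * b l 0 * M (lift 0 k) (lift 0 l)).
    rewrite exchange_big mulr_sumr -sumrN; apply: eq_bigr => k _.
    rewrite mulr_sumr -sumrN; apply: eq_bigr => l _.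
    by rewrite !bE; ring.
  have -> : \sum_(k < n) a * b k 0 * M 0 (lift 0 k) =
      a * \sum_(k < n) b k 0 * M 0 (lift 0 k).
    by rewrite mulr_sumr; apply: eq_bigr => k _; ring.
  have -> : \sum_(k < n) b k 0 * a * M (lift 0 k) 0 =
      a * \sum_(k < n) b k 0 * M (lift 0 k) 0.
    by rewrite mulr_sumr; apply: eq_bigr => k _; ring.
  by field; rewrite gt_eqF.
rewrite trE addr_ge0 ?mulr_ge0 ?invr_ge0 ?(ltW a0) //.
apply: IH => [|xi xi0|xi].
- by apply/matrixP => k l; rewrite !mxE symAE; congr (_ - a^-1 * _); exact: mulrC.
- rewrite quadS posA //; apply: contra_neq xi0 => /matrixP e0.
  by apply/colP => k; have := e0 (lift 0 k) 0; rewrite extl !mxE.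
(* The block [M'] inherits nonnegativity by testing [M] on vectors with first coordinate zero. *)
- have := posM (ext 0 xi); rewrite !quad_formE big_ord_recl big1 ?add0r.
    congr (0 <= _); apply: eq_bigr => k _; rewrite big_ord_recl ext0 !extl mulr0 mul0r add0r.
    by apply: eq_bigr => l _; rewrite !extl mxE.
  by move=> k _; rewrite ext0 !mul0r.
Qed.

(** * Partial derivatives and the second derivative test *)

Lemma partial_exists_entry (R : realType) (n m p : nat) (k : 'I_n)
    (g : 'cV[R]_n -> 'M[R]_(m, p)) x i j :
  partial_exists k g x -> partial_exists k (fun y => g y i j) x.
Proof. by move=> /derivable_mxP; exact. Qed.

Lemma partial_entry (R : realType) (n m p : nat) (k : 'I_n)
    (g : 'cV[R]_n -> 'M[R]_(m, p)) x i j :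
  partial_exists k g x -> partial k (fun y => g y i j) x = partial k g x i j.
Proof. by move=> gx; rewrite /partial derive_mx // mxE. Qed.

(** Both difference quotients are the same function of [h], so one-variable calculus applies along
    lines. *)
Lemma is_derive_line (R : realType) (V W : normedModType R) (g : V -> W)
    (x v : V) (s : R) :
  derivable g (x + s *: v) v ->
  is_derive s 1 (fun h => g (x + h *: v)) ('D_v g (x + s *: v)).
Proof.
have E : (fun h : R => h^-1 *: (g (x + (h *: (1 : R) + s) *: v) - g (x + s *: v)))
       = (fun h => h^-1 *: (g (h *: v + (x + s *: v)) - g (x + s *: v))).
  apply/funext => h; rewrite [h *: 1]mulr1 scalerDl.
  by rewrite addrCA.
by move=> gv; apply: DeriveDef; rewrite /derivable /derive E.
Qed.

(** Locating the intermediate point by its relative position [th] covers increments of either sign,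
    and zero, in one formula. *)
Lemma mean_value_segment (R : realType) (f df : R -> R) (a : R) :
  (forall s : R, is_derive s 1 f (df s)) ->
  exists2 th, 0 <= th <= 1 & f a - f 0 = a * df (th * a).
Proof.
move=> fd.
have cf : continuous f by move=> s; exact/differentiable_continuous/derivable1_diffP.
have [a0|a0|->] := ltgtP a 0; last by exists 0; rewrite ?lexx ?ler01 // mul0r subrr.
- have [c] := @MVT R f df a 0 a0 (fun s _ => fd s) (continuous_subspaceT cf).
  rewrite in_itv /= => /andP[ac c0] E; exists (c / a).
    rewrite ler_ndivlMr // mul0r (ltW c0) /=.
    by rewrite ler_ndivrMr // mul1r ltW.
  by rewrite divfK ?lt_eqF // -opprB E; ring.
- have [c] := @MVT R f df 0 a a0 (fun s _ => fd s) (continuous_subspaceT cf).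
  rewrite in_itv /= => /andP[c0 ac] E; exists (c / a).
    by rewrite divr_ge0 ?(ltW a0) ?(ltW c0) //= ler_pdivrMr // mul1r ltW.
  by rewrite divfK ?gt_eqF // E subr0 mulrC.
Qed.

(** The path from [x] to [x + v] moves one coordinate at a time, and each move is a one-variable
    mean value theorem. Each [xi k] lies entrywise between the end points, which yields both
    closeness to [x] and membership in the orthant later on. *)
Lemma mean_value_partial (R : realType) (n : nat) (g : 'cV[R]_n -> R)
    (x v : 'cV[R]_n) :
  (forall k y, partial_exists k g y) ->
  exists2 xi : 'I_n -> 'cV[R]_n,
    (forall k l, exists2 th, 0 <= th <= 1 & xi k l 0 = x l 0 + th * v l 0) &
    g (x + v) - g x = \sum_k v k 0 * partial k g (xi k).
Proof.
move=> gp.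
(* Corner of the path at which exactly the coordinates of index below [j] have been moved. *)
pose z (j : nat) : 'cV[R]_n := \col_k (x k 0 + (k < j)%:R * v k 0).
have zS (j : 'I_n) : z j.+1 = z j + v j 0 *: delta_mx j 0.
  apply/colP => k; rewrite !mxE ltnS leq_eqVlt andbT -val_eqE /=.
  by case: eqP => [/val_inj->|_]; rewrite ?ltnn /=; ring.
have step (j : 'I_n) : exists2 th, 0 <= th <= 1 &
    g (z j.+1) - g (z j) = v j 0 * partial j g (z j + (th * v j 0) *: delta_mx j 0).
  have [|th th01 E] := @mean_value_segment R (fun s => g (z j + s *: delta_mx j 0))
     (fun s => partial j g (z j + s *: delta_mx j 0)) (v j 0).
    by move=> s; apply: is_derive_line; exact: gp.
  by exists th => //; rewrite zS -E scale0r addr0.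
have [th th01 thE] : exists2 th : 'I_n -> R, (forall j, 0 <= th j <= 1) &
    forall j : 'I_n, g (z j.+1) - g (z j)
       = v j 0 * partial j g (z j + (th j * v j 0) *: delta_mx j 0).
  have /choice[th H] : forall j : 'I_n, exists th, (0 <= th <= 1) /\
     g (z j.+1) - g (z j) = v j 0 * partial j g (z j + (th * v j 0) *: delta_mx j 0).
    by move=> j; have [t ? ?] := step j; exists t.
  by exists th => j; case: (H j).
exists (fun j : 'I_n => z j + (th j * v j 0) *: delta_mx j 0).
  move=> k l; rewrite !mxE andbT.
  have [->|lk] := eqVneq l k.
    by exists (th k) => //; rewrite ltnn /= mulr1 mul0r addr0.
  (* Coordinates before [k] have moved completely, those after [k] not at all. *)
  exists (l < k)%:R; first by case: (l < k)%N; rewrite ?lexx ?ler01.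
  by rewrite mulr0 addr0.
have <- : g (z n) - g (z 0) = g (x + v) - g x.
  congr (g _ - g _); apply/colP => k; rewrite !mxE ?ltn_ord ?mul1r //.
  by rewrite mul0r addr0.
rewrite -(@telescope_sumr _ 0%N n (fun j => g (z j))) // big_mkord.
by apply: eq_bigr => j _; exact: thE.
Qed.

(** In the coordinatewise mean value formula for the increment [h *: v] the factor [h] cancels, and
    the intermediate points tend to [y]; continuity of the partial derivatives gives the limit. *)
Lemma is_derive_partial (R : realType) (n : nat) (g : 'cV[R]_n -> R)
    (x v : 'cV[R]_n) (s : R) :
  (forall k y, partial_exists k g y) -> (forall k, continuous (partial k g)) ->
  is_derive s 1 (fun h => g (x + h *: v)) (\sum_k v k 0 * partial k g (x + s *: v)).
Proof.
move=> gp gc; set y := x + s *: v; set D := \sum_k _.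
suff H : (fun h : R => h^-1 *: (g (x + (h *: (1 : R) + s) *: v) - g y)) @ 0^' --> D.
  by apply: DeriveDef; [apply/cvg_ex; exists D|exact/cvg_lim].
apply/cvgrPdist_le => e e0.
(* The summand 1, here and in the bound on [h] below, keeps the divisor positive when [v = 0]. *)
pose V := \sum_k `|v k 0| + 1.
have V0 : 0 < V by rewrite ltr_wpDl // sumr_ge0.
have : \forall z \near y, forall k, `|partial k g y - partial k g z| <= e / V.
  have F k : \forall z \near y, `|partial k g y - partial k g z| <= e / V.
    by move/cvgrPdist_le : (gc k y); apply; exact: divr_gt0.
  exact: (@filter_forall _ _ _ (nbhs y) _ F).
case/nbhs_ballP => r /= r0 Hr.
have rv : 0 < r / (`|v| + 1) by rewrite divr_gt0 // ltr_wpDl.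
near=> h.
have h0 : h != 0 by near: h; exact: nbhs_dnbhs_neq.
have hr : `|h| < r / (`|v| + 1) by near: h; exact: dnbhs0_lt.
have -> : x + (h *: 1 + s) *: v = y + h *: v.
  by rewrite [h *: 1]mulr1 scalerDl /y addrCA addrC.
have [xi xiE ->] := @mean_value_partial R n g y (h *: v) gp.
have -> : h^-1 *: (\sum_k (h *: v) k 0 * partial k g (xi k))
    = \sum_k v k 0 * partial k g (xi k).
  rewrite scaler_sumr; apply: eq_bigr => k _.
  by rewrite mxE /GRing.scale /= !mulrA mulVf // mul1r.
rewrite /D -sumrB; apply: le_trans (ler_norm_sum _ _ _) _.
apply: (@le_trans _ _ (\sum_k `|v k 0| * (e / V))).
  apply: ler_sum => k _; rewrite -mulrBr normrM ler_wpM2l //.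
  apply: Hr; rewrite mx_norm_ball /ball_ /=.
  rewrite [ltLHS]/Num.Def.normr /= mx_normrE; apply/bigmax_ltP; split => // -[l j] _ /=.
  have [th /andP[th0 th1] E] := xiE k l.
  have -> : (y - xi k) l j = - (th * (h * v l 0)).
    by rewrite ord1 mxE [(- xi k) l 0]mxE E [(h *: v) l 0]mxE; ring.
  rewrite normrN !normrM (ger0_norm th0).
  have vl : `|v l 0| <= `|v|.
    by rewrite [leRHS]/Num.Def.normr /= mx_normrE; apply: (le_bigmax _ _ (l, 0)).
  apply: (@le_lt_trans _ _ (`|h| * `|v|)).
    by rewrite -[leRHS]mul1r ler_pM // ?mulr_ge0 // ler_wpM2l.
  apply: (@le_lt_trans _ _ (`|h| * (`|v| + 1))).
    by rewrite ler_wpM2l // lerDl.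
  by rewrite -ltr_pdivlMr // ltr_wpDl.
rewrite -mulr_suml mulrA ler_pdivrMr // mulrC ler_wpM2l ?(ltW e0) //.
by rewrite lerDl.
Unshelve. all: by end_near. Qed.

Lemma partial_at_min (R : realType) (n : nat) (g : 'cV[R]_n -> R)
    (y : 'cV[R]_n) (k : 'I_n) :
  (forall x, partial_exists k g x) -> (forall x, g y <= g x) ->
  partial k g y = 0.
Proof.
move=> gp ymin.
have L (s : R) := @is_derive_line R _ _ g y (delta_mx k 0) s (gp _).
have [||||_ <-] := @derive1_at_min R (fun s => g (y + s *: delta_mx k 0)) (-1) 1 0.
- by lra.
- by move=> t _; have [] := L t.
- by rewrite in_itv /= ltrN10 ltr01.
- by move=> t _; rewrite scale0r addr0.
- by have [_ ->] := L 0; rewrite scale0r addr0.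
Qed.

(** Along the line through [y] in direction [v] the first derivative [G] vanishes at 0. A negative
    second derivative would make [G] negative just after 0, and the mean value theorem would produce
    a value below the minimum. *)
Lemma hess_at_min (R : realType) (n : nat) (g : 'cV[R]_n -> R)
    (y : 'cV[R]_n) :
  C2 g -> (forall x, g y <= g x) ->
  forall v, 0 <= dot v (hess g y *m v).
Proof.
move=> [_ gp gc gpp gpc] ymin v.
pose G (s : R) := \sum_k v k 0 * partial k g (y + s *: v).
have dg (s : R) : is_derive s 1 (fun h => g (y + h *: v)) (G s).
  by apply: is_derive_partial => // k x; exact: gp.
have dG (s : R) : is_derive s 1 G (\sum_k v k 0 *
    \sum_l v l 0 * partial l (partial k g) (y + s *: v)).
  rewrite /G; have -> : (fun s : R => \sum_k v k 0 * partial k g (y + s *: v))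
     = \sum_k (fun s : R => v k 0 *: partial k g (y + s *: v)).
    by apply/funext => s'; rewrite fct_sumE.
  apply: is_derive_sum => k; apply: is_deriveZ.
  exact: (@is_derive_partial R n (partial k g) y v s (fun l x => gpp l k x) (fun l => gpc l k)).
have G0 : G 0 = 0.
  by rewrite /G big1 // => k _; rewrite scale0r addr0 partial_at_min ?mulr0.
have [dG1 dG2] := dG 0.
rewrite leNgt; apply/negP => H.
have qE : \sum_k v k 0 * (\sum_l v l 0 * partial l (partial k g) (y + (0 : R) *: v))
    = dot v (hess g y *m v).
  rewrite quad_formE exchange_big; apply: eq_bigr => k _; rewrite mulr_sumr scale0r addr0.
  by apply: eq_bigr => l _; rewrite !mxE; ring.
rewrite qE in dG2.
have : \forall h \near 0^', h^-1 *: (G (h *: (1 : R) + 0) - G 0) < 0.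
  by apply: (cvgr_lt _ dG1); rewrite -[X in X < _]/('D_1 G 0) dG2.
move=> /nbhs_ballP [r /= r0 Hr].
have Gneg s : 0 < s < r -> G s < 0.
  move=> /andP[s0 sr]; have := Hr s.
  rewrite /ball /= sub0r normrN gtr0_norm // => /(_ sr (lt0r_neq0 s0)).
  by rewrite G0 subr0 [s *: 1]mulr1 addr0 /GRing.scale /= pmulr_rlt0 // invr_gt0.
have cf : continuous (fun h : R => g (y + h *: v)).
  by move=> s; have [d _] := dg s; exact/differentiable_continuous/derivable1_diffP.
have r20 : 0 < r / 2 by rewrite divr_gt0.
have [c] := @MVT R _ _ 0 (r / 2) r20 (fun s _ => dg s) (continuous_subspaceT cf).
rewrite in_itv /= => /andP[c0 cr] E.
have : g (y + (r / 2) *: v) - g (y + 0 *: v) < 0.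
  rewrite E pmulr_llt0 ?subr0 // Gneg // c0 (lt_trans cr) //.
  by rewrite ltr_pdivrMr // ltr_pMr // ltr1n.
by rewrite scale0r addr0 subr_lt0 ltNge ymin.
Qed.

(** * Gaussian barriers *)

(** Compactness of a product of segments is carried from rows to columns by the continuous
    transposition. *)
Lemma compact_cube (R : realType) (n : nat) (y : 'cV[R]_n) (r : R) :
  compact [set x : 'cV[R]_n | forall k, `|x k 0 - y k 0| <= r].
Proof.
have trc : continuous (fun x : 'rV[R]_n => x^T : 'cV[R]_n).
  move=> x s /= /nbhs_ballP[e e0 es]; apply/nbhs_ballP; exists e => //= z [_ xz].
  by apply: es; split=> // i j; rewrite !mxE; exact: xz.
have /(continuous_compact (continuous_subspaceT trc)) :=
  @rV_compact R n (fun k => `[y k 0 - r, y k 0 + r]%classic)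
    (fun k => @segment_compact _ _ _).
move=> C; apply: (eq_rect _ compact C); apply/seteqP; split => [_ [x xy <-] k|x xy] /=.
  by have := xy k; rewrite /= in_itv /= mxE ler_distl.
exists x^T; last exact: trmxK.
by move=> k; rewrite /= in_itv /= mxE -ler_distl.
Qed.

(** Converse passage at parameter 0: a directional derivative is obtained by differentiating a
    function of one real variable. *)
Lemma is_derive_of_line (R : realType) (V W : normedModType R) (g : V -> W)
    (x v : V) (D : W) :
  is_derive (0 : R) 1 (fun h : R => g (x + h *: v)) D -> is_derive x v g D.
Proof.
have E : (fun h : R => h^-1 *: (g (x + (h *: (1 : R) + 0) *: v) - g (x + (0 : R) *: v)))
       = (fun h => h^-1 *: (g (h *: v + x) - g x)).
  by apply/funext => h; rewrite [h *: 1]mulr1 addr0 scale0r addr0 [x + _]addrC.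
by case; rewrite /derivable /derive E => d1 d2; apply: DeriveDef.
Qed.

Lemma partialB (R : realType) (n : nat) (f g : 'cV[R]_n -> R) k x :
  partial_exists k f x -> partial_exists k g x ->
  partial k (fun y => f y - g y) x = partial k f x - partial k g x.
Proof. exact: deriveB. Qed.

Lemma partialZ (R : realType) (n : nat) (c : R) (f : 'cV[R]_n -> R) k x :
  partial_exists k f x -> partial k (fun y => c * f y) x = c * partial k f x.
Proof. exact: deriveZ. Qed.

Lemma C2B (R : realType) (n : nat) (f g : 'cV[R]_n -> R) :
  C2 f -> C2 g -> C2 (fun x => f x - g x).
Proof.
move=> [fc fp fpc fpp fppc] [gc gp gpc gpp gppc].
have E l : partial l (fun x => f x - g x) = (fun x => partial l f x - partial l g x).
  by apply/funext => x; exact: partialB.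
have E2 k l : partial k (partial l (fun x => f x - g x)) =
    (fun x => partial k (partial l f) x - partial k (partial l g) x).
  by apply/funext => x; rewrite E; exact: partialB.
split.
- by move=> x; apply: continuousB; [exact: fc|exact: gc].
- by move=> k x; apply: derivableB; [exact: fp|exact: gp].
- by move=> k; rewrite E => x; apply: continuousB; [exact: fpc|exact: gpc].
- by move=> k l x; rewrite E; apply: derivableB; [exact: fpp|exact: gpp].
- by move=> k l; rewrite E2 => x; apply: continuousB; [exact: fppc|exact: gppc].
Qed.

Lemma C2Z (R : realType) (n : nat) (c : R) (f : 'cV[R]_n -> R) :
  C2 f -> C2 (fun x => c * f x).
Proof.
move=> [fc fp fpc fpp fppc].
have E l : partial l (fun x => c * f x) = (fun x => c * partial l f x).
  by apply/funext => x; exact: partialZ.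
have E2 k l : partial k (partial l (fun x => c * f x)) =
    (fun x => c * partial k (partial l f) x).
  by apply/funext => x; rewrite E; exact: partialZ.
split.
- by move=> x; apply: continuousM; [exact: cst_continuous|exact: fc].
- by move=> k x; apply: derivableZ; exact: fp.
- by move=> k; rewrite E => x; apply: continuousM; [exact: cst_continuous|exact: fpc].
- by move=> k l x; rewrite E; apply: derivableZ; exact: fpp.
- by move=> k l; rewrite E2 => x; apply: continuousM; [exact: cst_continuous|exact: fppc].
Qed.

(** Barriers are radial for the Euclidean distance, whereas the norm on columns is the maximum norm;
    the square avoids roots. *)
Definition sqdist (R : realType) (n : nat) (y x : 'cV[R]_n) : R :=
  dot (x - y) (x - y).

Lemma sqdistE (R : realType) (n : nat) (y x : 'cV[R]_n) :
  sqdist y x = \sum_k (x k 0 - y k 0) ^+ 2.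
Proof. by rewrite /sqdist dotE; apply: eq_bigr => k _; rewrite !mxE expr2. Qed.

Lemma sqdist_entry (R : realType) (n : nat) (y x : 'cV[R]_n) k :
  (x k 0 - y k 0) ^+ 2 <= sqdist y x.
Proof.
by rewrite sqdistE (bigD1 k) //= lerDl sumr_ge0 // => j _; exact: sqr_ge0.
Qed.

Lemma sqdist_norm (R : realType) (n : nat) (y x : 'cV[R]_n) (r : R) :
  0 <= r -> sqdist y x <= r ^+ 2 -> `|x - y| <= r.
Proof.
move=> r0 xr; rewrite [leLHS]/Num.Def.normr /= mx_normrE.
apply: bigmax_le => // -[k j] _ /=; rewrite ord1 !mxE.
rewrite -(@ler_pXn2r _ 2) ?nnegrE // real_normK ?num_real //.
exact: le_trans (sqdist_entry _ _ _) xr.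
Qed.

Lemma continuous_entryB (R : realType) (n : nat) (y : 'cV[R]_n) k :
  continuous (fun x : 'cV[R]_n => x k 0 - y k 0).
Proof. by move=> x; apply: continuousB; [exact: coord_continuous|exact: cst_continuous]. Qed.

Lemma is_derive_entryB (R : realType) (n : nat) (y x : 'cV[R]_n) (k l : 'I_n) :
  is_derive x (delta_mx l 0) (fun x : 'cV[R]_n => x k 0 - y k 0) (k == l)%:R.
Proof.
apply: is_derive_of_line.
have -> : (fun h : R => (x + h *: delta_mx l 0) k 0 - y k 0) =
    (fun h : R => h * (k == l)%:R + (x k 0 - y k 0)).
  by apply/funext => h; rewrite !mxE andbT; ring.
have -> : (fun h : R => h * (k == l)%:R + (x k 0 - y k 0)) =
    (k == l)%:R *: id + cst (x k 0 - y k 0).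
  by apply/funext => h; rewrite mulrC.
by apply: is_derive_eq; rewrite addr0 [_ *: 1]mulr1.
Qed.

Definition gauss (R : realType) (n : nat) (y : 'cV[R]_n) (a : R) (x : 'cV[R]_n) : R :=
  expR (- a * sqdist y x).

Lemma continuous_sqdist (R : realType) (n : nat) (y : 'cV[R]_n) :
  continuous (sqdist y).
Proof.
have -> : sqdist y = (fun x => \sum_k (x k 0 - y k 0) * (x k 0 - y k 0)).
  by apply/funext => x; rewrite sqdistE; apply: eq_bigr => k _; rewrite expr2.
have C k : continuous (fun x : 'cV[R]_n => (x k 0 - y k 0) * (x k 0 - y k 0)).
  by move=> x; have cx := @continuous_entryB R n y k x; exact: (continuousM cx cx).
by apply: (continuous_big (op := +%R)) => [|k _]; [exact: add_continuous|exact: C].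
Qed.

Lemma continuous_gauss (R : realType) (n : nat) (y : 'cV[R]_n) a :
  continuous (gauss y a).
Proof.
move=> x; apply: continuous_comp; last exact: continuous_expR.
by apply: continuousM; [exact: cst_continuous|exact: continuous_sqdist].
Qed.

Lemma is_derive_gauss (R : realType) (n : nat) (y x : 'cV[R]_n) (a : R) (k : 'I_n) :
  is_derive x (delta_mx k 0) (gauss y a) (- (2 * a) * (x k 0 - y k 0) * gauss y a x).
Proof.
apply: is_derive_of_line.
(* Expansion in [h] of the exponent along the line through [x] in direction [k]. *)
pose p (h : R) := (- a * sqdist y x) + (- (2 * a) * (x k 0 - y k 0)) * h + - a * (h * h).
have -> : (fun h : R => gauss y a (x + h *: delta_mx k 0)) = expR \o p.
  apply/funext => h; rewrite /gauss /p /=; congr expR.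
  rewrite !sqdistE (bigD1 k) //= [in RHS](bigD1 k) //= !mxE eqxx mulr1.
  under eq_bigr => l lk do rewrite !mxE (negbTE lk) mulr0 addr0.
  by ring.
have p0 : p 0 = - a * sqdist y x by rewrite /p !mulr0 !addr0.
have dp : is_derive (0 : R) 1 p (- (2 * a) * (x k 0 - y k 0)).
  have dsq : is_derive (0 : R) 1 (id * id : R -> R) 0.
    have := @is_deriveM R R id id 0 1 1 1 (is_derive_id _ _) (is_derive_id _ _).
    by rewrite !scale0r addr0.
  have dlin : is_derive (0 : R) 1 ((- (2 * a) * (x k 0 - y k 0)) *: id : R -> R)
      (- (2 * a) * (x k 0 - y k 0)).
    have := @is_deriveZ R R R id (- (2 * a) * (x k 0 - y k 0)) 0 1 1 (is_derive_id _ _).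
    by rewrite [_ *: 1]mulr1.
  have := is_deriveD (is_deriveD (is_derive_cst (- a * sqdist y x) (0 : R) 1) dlin)
    (is_deriveZ (- a) dsq).
  by rewrite add0r scaler0 addr0.
rewrite mulrC /gauss -p0; exact: is_derive1_comp (is_derive_expR (p 0)) dp.
Qed.

Lemma quad_form_outer (R : realType) (n : nat) (M : 'M[R]_n) (x : 'cV[R]_n) :
  \tr (M *m (x *m x^T)) = dot x (M *m x).
Proof. by rewrite mulmxA mxtrace_mulC /dot /mxtrace big_ord1. Qed.

(** Hopf's barrier: the Gaussian is lowered so as to vanish on the sphere of radius [r]; for [a > 0]
    and [r > 0] it is positive inside and negative outside. *)
Definition bump (R : realType) (n : nat) (y : 'cV[R]_n) (a r : R) (x : 'cV[R]_n) : R :=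
  gauss y a x - expR (- a * r ^+ 2).

Lemma is_derive_bump (R : realType) (n : nat) (y x : 'cV[R]_n) (a r : R) (k : 'I_n) :
  is_derive x (delta_mx k 0) (bump y a r) (- (2 * a) * (x k 0 - y k 0) * gauss y a x).
Proof.
have := is_deriveB (is_derive_gauss y x a k)
  (is_derive_cst (expR (- a * r ^+ 2)) x (delta_mx k 0)).
by rewrite subr0.
Qed.

Lemma partial_bump (R : realType) (n : nat) (y : 'cV[R]_n) (a r : R) (k : 'I_n) :
  partial k (bump y a r) = fun x => - (2 * a) * (x k 0 - y k 0) * gauss y a x.
Proof. by apply/funext => x; have [_] := is_derive_bump y x a r k. Qed.

Lemma is_derive_partial_bump (R : realType) (n : nat) (y x : 'cV[R]_n) (a r : R)
    (k l : 'I_n) :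
  is_derive x (delta_mx l 0) (partial k (bump y a r))
   ((4 * a ^+ 2 * ((x k 0 - y k 0) * (x l 0 - y l 0)) - 2 * a * (k == l)%:R)
    * gauss y a x).
Proof.
rewrite partial_bump.
have D := is_deriveM (is_deriveZ (- (2 * a)) (is_derive_entryB y x k l))
  (is_derive_gauss y x a l).
apply: (is_derive_eq D).
have sE (u v : R) : u *: v = u * v by [].
by rewrite !sE /= sE; ring.
Qed.

Lemma C2_bump (R : realType) (n : nat) (y : 'cV[R]_n) (a r : R) : C2 (bump y a r).
Proof.
have cE k : continuous (fun x : 'cV[R]_n => - (2 * a) * (x k 0 - y k 0)).
  move=> x; exact: (continuousM (@cst_continuous _ _ (- (2 * a)) x) (@continuous_entryB R n y k x)).
have cg := @continuous_gauss R n y a.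
have cEE k l : continuous (fun x : 'cV[R]_n =>
    4 * a ^+ 2 * ((x k 0 - y k 0) * (x l 0 - y l 0)) - 2 * a * (k == l)%:R).
  move=> x.
  have c1 := continuousM (@continuous_entryB R n y k x) (@continuous_entryB R n y l x).
  have c2 := continuousM (@cst_continuous _ _ (4 * a ^+ 2) x) c1.
  exact: (continuousB c2 (@cst_continuous _ _ (2 * a * (k == l)%:R) x)).
have EE k l : partial l (partial k (bump y a r)) = (fun x =>
    (4 * a ^+ 2 * ((x k 0 - y k 0) * (x l 0 - y l 0)) - 2 * a * (k == l)%:R) * gauss y a x).
  by apply/funext => x; have [_] := is_derive_partial_bump y x a r k l.
split.
- by move=> x; exact: (continuousB (cg x) (@cst_continuous _ _ (expR (- a * r ^+ 2)) x)).
- by move=> k x; have [] := is_derive_bump y x a r k.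
- by move=> k; rewrite partial_bump => x; exact: (continuousM (cE k x) (cg x)).
- by move=> k l x; have [] := is_derive_partial_bump y x a r l k.
- by move=> k l; rewrite EE => x; exact: (continuousM (cEE l k x) (cg x)).
Qed.

(** * Maximum principle *)

(** Comparison is carried out for this form only; [scalar_op_nondiv] brings both forms of
    [scalar_op] to it. *)
Definition nondiv_op (R : realType) (n : nat) (A : 'cV[R]_n -> 'M[R]_n)
    (q : 'cV[R]_n -> 'cV[R]_n) (psi : 'cV[R]_n -> R) (x : 'cV[R]_n) : R :=
  - \tr (A x *m hess psi x) + dot (q x) (grad psi x).

Lemma dotDr (R : realType) (n : nat) (x y z : 'cV[R]_n) :
  dot x (y + z) = dot x y + dot x z.
Proof. by rewrite /dot mulmxDr mxE. Qed.

Lemma dotZr (R : realType) (n : nat) (c : R) (x y : 'cV[R]_n) :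
  dot x (c *: y) = c * dot x y.
Proof. by rewrite /dot -scalemxAr mxE. Qed.

Lemma hess_entry (R : realType) (n : nat) (f : 'cV[R]_n -> R) x k l :
  hess f x k l = partial k (partial l f) x.
Proof. by rewrite mxE. Qed.

Lemma nondiv_opB (R : realType) (n : nat) (A : 'cV[R]_n -> 'M[R]_n)
    (q : 'cV[R]_n -> 'cV[R]_n) (f g : 'cV[R]_n -> R) (x : 'cV[R]_n) :
  C2 f -> C2 g ->
  nondiv_op A q (fun z => f z - g z) x = nondiv_op A q f x - nondiv_op A q g x.
Proof.
move=> [fc fp fpc fpp fppc] [gc gp gpc gpp gppc]; rewrite /nondiv_op.
have -> : grad (fun z => f z - g z) x = grad f x + -1 *: grad g x.
  by apply/colP => k; rewrite !mxE partialB // mulN1r.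
have -> : hess (fun z => f z - g z) x = hess f x + -1 *: hess g x.
  apply/matrixP => k l.
  have -> (M M' : 'M[R]_n) : (M + -1 *: M') k l = M k l - M' k l.
    by rewrite !mxE mulN1r.
  apply: etrans (hess_entry _ _ _ _) (etrans _ (esym
    (congr2 (fun a b => a - b) (hess_entry f x k l) (hess_entry g x k l)))).
  apply: etrans _ (partialB (fpp k l x) (gpp k l x)).
  by congr partial; apply/funext => z; exact: partialB.
rewrite dotDr dotZr mulmxDr -scalemxAr mxtraceD mxtraceZ.
by rewrite !mulN1r opprD addrACA opprD.
Qed.

Lemma nondiv_opZ (R : realType) (n : nat) (A : 'cV[R]_n -> 'M[R]_n)
    (q : 'cV[R]_n -> 'cV[R]_n) (c : R) (f : 'cV[R]_n -> R) (x : 'cV[R]_n) :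
  C2 f -> nondiv_op A q (fun z => c * f z) x = c * nondiv_op A q f x.
Proof.
move=> [fc fp fpc fpp fppc]; rewrite /nondiv_op.
have -> : grad (fun z => c * f z) x = c *: grad f x.
  by apply/colP => k; rewrite !mxE partialZ.
have -> : hess (fun z => c * f z) x = c *: hess f x.
  apply/matrixP => k l.
  have -> (M : 'M[R]_n) : (c *: M) k l = c * M k l by rewrite mxE.
  apply: etrans (hess_entry _ _ _ _) (etrans _ (esym
    (congr1 (fun a => c * a) (hess_entry f x k l)))).
  apply: etrans _ (partialZ c (fpp k l x)).
  by congr partial; apply/funext => z; exact: partialZ.
by rewrite dotZr -scalemxAr mxtraceZ mulrDr mulrN.
Qed.

Lemma nondiv_op_bump (R : realType) (n : nat) (A : 'cV[R]_n -> 'M[R]_n)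
    (q : 'cV[R]_n -> 'cV[R]_n) (y x : 'cV[R]_n) (a r : R) :
  nondiv_op A q (bump y a r) x = gauss y a x *
   (2 * a * (\tr (A x) - dot (q x) (x - y)) - 4 * a ^+ 2 * dot (x - y) (A x *m (x - y))).
Proof.
rewrite /nondiv_op.
have -> : grad (bump y a r) x = (- (2 * a) * gauss y a x) *: (x - y).
  by apply/colP => k; rewrite !mxE partial_bump; ring.
have -> : hess (bump y a r) x = (4 * a ^+ 2 * gauss y a x) *: ((x - y) *m (x - y)^T)
    + (- (2 * a * gauss y a x))%:M.
  apply/matrixP => k l; have [_ E] := is_derive_partial_bump y x a r l k.
  rewrite mxE [LHS]E !mxE big_ord1 !mxE eq_sym -mulr_natr; ring.
rewrite mulmxDr mxtraceD -scalemxAr mxtraceZ quad_form_outer mul_mx_scalar mxtraceZ dotZr.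
set t := \tr _; set u := dot _ _; set v := dot _ _; ring.
Qed.

(** Away from the centre the term quadratic in [a] wins for large [a], so the bump is there a strict
    subsolution. *)
Lemma nondiv_op_bump_le (R : realType) (n : nat) (A : 'cV[R]_n -> 'M[R]_n)
    (q : 'cV[R]_n -> 'cV[R]_n) (y x : 'cV[R]_n) (a r g T : R) :
  0 <= a -> \tr (A x) - dot (q x) (x - y) <= T ->
  g * sqdist y x <= dot (x - y) (A x *m (x - y)) ->
  nondiv_op A q (bump y a r) x
    <= gauss y a x * (2 * a * T - 4 * a ^+ 2 * (g * sqdist y x)).
Proof.
move=> a0 xT xg; rewrite nondiv_op_bump ler_wpM2l ?expR_ge0 // lerB //.
  by rewrite ler_wpM2l // mulr_ge0.
by rewrite ler_wpM2l // mulr_ge0 // sqr_ge0.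
Qed.

(** At a minimum the gradient vanishes and the Hessian has a nonnegative quadratic form, so
    [mxtrace_mul_ge0] gives the sign. *)
Lemma nondiv_op_at_min (R : realType) (n : nat) (A : 'cV[R]_n -> 'M[R]_n)
    (q : 'cV[R]_n -> 'cV[R]_n) (g : 'cV[R]_n -> R) (y : 'cV[R]_n) :
  (A y)^T = A y -> (forall xi, xi != 0 -> 0 < dot xi (A y *m xi)) ->
  C2 g -> (forall x, g y <= g x) -> nondiv_op A q g y <= 0.
Proof.
move=> As Ap gC2 ymin; have [gc gp _ _ _] := gC2.
have -> : nondiv_op A q g y = - \tr (A y *m hess g y).
  rewrite /nondiv_op (_ : grad g y = 0 *: grad g y) ?dotZr ?mul0r ?addr0 //.
  by apply/colP => k; rewrite !mxE mul0r; exact: partial_at_min.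
by rewrite oppr_le0 mxtrace_mul_ge0 //; exact: hess_at_min.
Qed.

(* The penalisation [kappa (t - t0)^2] makes up for the noncompactness of the
   time line: it forces a minimum at the price of a time derivative of order
   [sqrt kappa]. *)
Lemma approximate_touching (R : realType) (n : nat) (A : 'cV[R]_n -> 'M[R]_n)
    (q : 'cV[R]_n -> 'cV[R]_n) (v : 'cV[R]_n -> R) (u : R -> 'cV[R]_n -> R)
    (y : 'cV[R]_n) (r M t0 : R) (x0 : 'cV[R]_n) (eps : R) :
  (forall x, (A x)^T = A x) ->
  (forall x xi, xi != 0 -> 0 < dot xi (A x *m xi)) ->
  C2 v -> (forall t, C2 (u t)) ->
  continuous (fun p : R * 'cV[R]_n => u p.1 p.2) ->
  (forall t x, derivable (u ^~ x) t 1) ->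
  (forall t x, u t x <= M) ->
  (forall t x, v x < u t x -> forall k, `|x k 0 - y k 0| <= r) ->
  v x0 < u t0 x0 -> 0 < eps ->
  exists t x, [/\ v x < u t x, - eps <= derive1 (u ^~ x) t &
                  nondiv_op A q v x <= nondiv_op A q (u t) x].
Proof.
move=> As Ap vC2 uC2 uc ud uM vK vu0 eps0.
pose K := [set x : 'cV[R]_n | forall k, `|x k 0 - y k 0| <= r].
have Kc : compact K := @compact_cube R n y r.
have x0K : K x0 := vK _ _ vu0.
have vc : continuous v by case: vC2.
have [xm xmK vm] := compact_EVT_min (ex_intro _ _ x0K) Kc (continuous_subspaceT vc).
have vm' x : K x -> v xm <= v x by move=> Kx; apply: vm; rewrite inE.
pose S := M - v xm.
have S0 : 0 < S.
  by rewrite subr_gt0 (le_lt_trans (vm' _ x0K)) // (lt_le_trans vu0).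
(* The choice gives [kap * tau ^+ 2 = S], which confines the set where [G < 0] to times within [tau]
   of [t0], and [2 * kap * tau = eps], which bounds the time derivative of the penalty there. *)
pose kap := eps ^+ 2 / (4 * S); pose tau := 2 * S / eps.
have kap0 : 0 < kap by rewrite divr_gt0 ?exprn_gt0 ?mulr_gt0.
have tau0 : 0 < tau by rewrite divr_gt0 ?mulr_gt0.
pose G (p : R * 'cV[R]_n) := v p.2 - u p.1 p.2 + kap * ((p.1 - t0) * (p.1 - t0)).
have Gneg t x : G (t, x) < 0 -> K x /\ `|t - t0| < tau.
  rewrite /G /= => Gn.
  have vux : v x < u t x.
    rewrite -subr_lt0; apply: le_lt_trans Gn; rewrite lerDl.
    by rewrite mulr_ge0 ?(ltW kap0) // -expr2 sqr_ge0.
  split; first exact: vK vux.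
  rewrite -(@ltr_pXn2r _ 2) ?nnegrE ?(ltW tau0) // real_normK ?num_real // expr2.
  have : kap * ((t - t0) * (t - t0)) < S.
    have := vm' _ (vK _ _ vux); have := uM t x; rewrite /S; lra.
  rewrite mulrC -ltr_pdivlMr // => /lt_le_trans; apply.
  rewrite /kap /tau le_eqVlt; apply/orP; left; apply/eqP; field.
  by rewrite !gt_eqF.
have Gc : continuous G.
  have c1 : continuous (fun p : R * 'cV[R]_n => v p.2).
    by move=> p; apply: continuous_comp; [exact: cvg_snd|exact: vc].
  have c2 : continuous (fun p : R * 'cV[R]_n => p.1 - t0).
    by move=> p; apply: continuousB; [exact: cvg_fst|exact: cst_continuous].
  move=> p; have c3 := continuousM (c2 p) (c2 p).
  have c4 := continuousM (@cst_continuous _ _ kap p) c3.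
  exact: (continuousD (continuousB (c1 p) (uc p)) c4).
have ball0 : `|t0 - t0| <= tau by rewrite subrr normr0 ltW.
have G0 : G (t0, x0) < 0 by rewrite /G /= subrr !mulr0 addr0 subr_lt0.
pose KK := (`[t0 - tau, t0 + tau] `*` K)%classic.
have KKc : compact KK by apply: compact_setX => //; exact: segment_compact.
have inKK t x : K x -> `|t - t0| <= tau -> KK (t, x).
  by move=> Kx tt; split => //=; rewrite in_itv /= -ler_distl.
have [[t x] _ Gmin] := compact_EVT_min (ex_intro _ _ (inKK _ _ x0K ball0)) KKc
  (continuous_subspaceT Gc).
have Gtx : G (t, x) < 0.
  by apply: le_lt_trans G0; apply: Gmin; rewrite inE; exact: inKK.
(* The minimum over the compact set is global, since [G] is nonnegative outside it and negative at
   [(t, x)]; hence the first and second order conditions hold. *)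
have {}Gmin t' x' : G (t, x) <= G (t', x').
  have [G'|/Gneg[Kx tt]] := leP 0 (G (t', x')); first exact: le_trans (ltW Gtx) G'.
  by apply: Gmin; rewrite inE; apply: inKK => //; exact: ltW.
exists t, x; split.
- rewrite -subr_lt0; apply: le_lt_trans Gtx; rewrite /G /= lerDl.
  by rewrite mulr_ge0 ?(ltW kap0) // -expr2 sqr_ge0.
- have [_ tt] := Gneg _ _ Gtx.
  have dsq : is_derive t 1 (fun s : R => kap * ((s - t0) * (s - t0)))
       (2 * kap * (t - t0)).
    have d1 := is_deriveB (is_derive_id t 1) (is_derive_cst t0 t 1).
    have := is_deriveZ kap (is_deriveM d1 d1).
    rewrite subr0; move/is_derive_eq; apply.
    have sE (a b : R) : a *: b = a * b by [].
    by rewrite !sE -[(id - cst t0) t]/(t - t0); ring.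
  have du := derivableP (ud t x).
  have dG := is_deriveB dsq du.
  have [||||_] := @derive1_at_min R
     (fun s => kap * ((s - t0) * (s - t0)) - u s x) (t - 1) (t + 1) t.
  + by lra.
  + move=> s _; apply: derivableB; last exact: ud.
    have d1 := is_deriveB (is_derive_id s 1) (is_derive_cst t0 s 1).
    by have [] := is_deriveZ kap (is_deriveM d1 d1).
  + by rewrite in_itv /=; lra.
  + by move=> s _; have := Gmin s x; rewrite /G /=; lra.
  case: dG => _ -> E; rewrite derive1E.
  have -> : 'D_1 (u^~ x) t = 2 * kap * (t - t0) by lra.
  have : - tau <= t - t0 by have := ltW tt; rewrite ler_norml => /andP[].
  have -> : - eps = 2 * kap * - tau.
    by rewrite /kap /tau; field; rewrite !gt_eqF.
  by move=> ?; rewrite ler_wpM2l // mulr_ge0 // ltW.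
- rewrite -subr_le0; apply: le_trans (_ : nondiv_op A q (fun z => v z - u t z) x <= 0).
    by rewrite le_eqVlt; apply/orP; left; apply/eqP; exact: esym (nondiv_opB A q x vC2 (uC2 t)).
  have xmin x' : v x - u t x <= v x' - u t x'.
    by have := Gmin t x'; rewrite /G /= lerD2r.
  exact: (@nondiv_op_at_min R n A q (fun z => v z - u t z) x (As x) (Ap x)
    (C2B vC2 (uC2 t)) xmin).
Qed.

(** * Time-uniform lower bounds by comparison with bumps *)

Lemma sqdist_ge0 (R : realType) (n : nat) (y x : 'cV[R]_n) : 0 <= sqdist y x.
Proof. by rewrite sqdistE sumr_ge0 // => k _; exact: sqr_ge0. Qed.

Lemma gauss_le1 (R : realType) (n : nat) (y x : 'cV[R]_n) (a : R) :
  0 <= a -> gauss y a x <= 1.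
Proof. by move=> a0; rewrite -expR0 ler_expR mulNr oppr_le0 mulr_ge0 // sqdist_ge0. Qed.

Lemma gauss_ge (R : realType) (n : nat) (y x : 'cV[R]_n) (a s : R) :
  0 <= a -> sqdist y x <= s -> expR (- a * s) <= gauss y a x.
Proof. by move=> a0 xs; rewrite ler_expR !mulNr lerN2 ler_wpM2l. Qed.

Lemma bump_le_gauss (R : realType) (n : nat) (y x : 'cV[R]_n) (a r : R) :
  bump y a r x <= gauss y a x.
Proof. by rewrite lerBlDr lerDl expR_ge0. Qed.

Lemma bump_le0 (R : realType) (n : nat) (y x : 'cV[R]_n) (a r : R) :
  0 <= a -> r ^+ 2 <= sqdist y x -> bump y a r x <= 0.
Proof. by move=> a0 xr; rewrite subr_le0 ler_expR !mulNr lerN2 ler_wpM2l. Qed.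

(** As the bump vanishes on its sphere, a uniform positive bound requires a smaller ball, here of
    radius [r] divided by the square root of 2. *)
Lemma bump_half (R : realType) (n : nat) (y : 'cV[R]_n) (a r : R) :
  0 < a -> 0 < r -> exists2 b, 0 < b &
    forall x, sqdist y x <= r ^+ 2 / 2 -> b <= bump y a r x.
Proof.
move=> a0 r0; exists (expR (- a * (r ^+ 2 / 2)) - expR (- a * r ^+ 2)).
  rewrite subr_gt0 ltr_expR !mulNr ltrN2 ltr_pM2l //.
  by rewrite ltr_pdivrMr // ltr_pMr ?exprn_gt0 // ltr1n.
by move=> x xr; rewrite lerB // gauss_ge // ltW.
Qed.

Lemma C12_C2 (R : realType) (n : nat) (u : R -> 'cV[R]_n -> R) (t : R) :
  C12 u -> C2 (u t).
Proof.
move=> [uc _ up upp].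
have sec (W : topologicalType) (h : R * 'cV[R]_n -> W) :
    continuous h -> continuous (fun x => h (t, x)).
  move=> hc x; apply: (continuous_comp (f := fun x => (t, x))); last exact: hc.
  by apply: (@cvg_pair _ _ _ (nbhs x) (nbhs t) (nbhs x)); [exact: cvg_cst|exact: cvg_id].
split.
- exact: (sec _ (fun p => u p.1 p.2)).
- by move=> k x; case: (up k).
- by move=> k; have [_ c] := up k; exact: (sec _ _ c).
- by move=> k l x; case: (upp k l).
- by move=> k l; have [_ c] := upp k l; exact: (sec _ _ c).
Qed.

(* [(d/dt + L)(v - u)] for a time-independent [v]. *)
Definition excess (R : realType) (n : nat) (A : 'cV[R]_n -> 'M[R]_n)
    (q : 'cV[R]_n -> 'cV[R]_n) (v : 'cV[R]_n -> R) (u : R -> 'cV[R]_n -> R)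
    (t : R) (x : 'cV[R]_n) : R :=
  nondiv_op A q v x - (derive1 (u ^~ x) t + nondiv_op A q (u t) x).

Lemma pos_of_elliptic (R : realType) (n : nat) (M : 'M[R]_n) (g : R) :
  0 < g -> (forall xi, g * dot xi xi <= dot xi (M *m xi)) ->
  forall xi, xi != 0 -> 0 < dot xi (M *m xi).
Proof.
move=> g0 gM xi xi0; apply: lt_le_trans (gM xi); rewrite mulr_gt0 //.
rewrite lt_def dotE sumr_ge0 ?andbT => [|k _]; last by rewrite -expr2 sqr_ge0.
apply: contra xi0 => /eqP/psumr_eq0P H; apply/eqP/colP => k.
by have /eqP := H (fun k _ => sqr_ge0 _) k isT; rewrite mulf_eq0 orbb mxE => /eqP.
Qed.

(** If the inequality failed, [approximate_touching] applied to [v - eta * bump] would give a point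
    of failure with excess at most [eta] times the operator on the bump plus [delta / 2], against
    the margin [delta]. Failure can occur only inside the ball, because outside it the bump is
    nonpositive and [u <= v]. *)
Lemma above_bump (R : realType) (n : nat) (A : 'cV[R]_n -> 'M[R]_n)
    (q : 'cV[R]_n -> 'cV[R]_n) (v : 'cV[R]_n -> R) (u : R -> 'cV[R]_n -> R)
    (y : 'cV[R]_n) (a r M eta delta : R) :
  (forall x, (A x)^T = A x) ->
  (forall x xi, xi != 0 -> 0 < dot xi (A x *m xi)) ->
  C2 v -> C12 u -> (forall t x, u t x <= M) -> (forall t x, u t x <= v x) ->
  0 <= a -> 0 <= r -> 0 < eta -> 0 < delta ->
  (forall t x, sqdist y x < r ^+ 2 -> v x - u t x < eta * bump y a r x ->
    eta * nondiv_op A q (bump y a r) x + delta <= excess A q v u t x) ->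
  forall t x, eta * bump y a r x <= v x - u t x.
Proof.
move=> As Ap vC2 uC12 uM uv a0 r0 eta0 delta0 H t0 x0.
rewrite leNgt; apply/negP => H0.
pose b x := eta * bump y a r x.
have bC2 : C2 b by apply: C2Z; exact: C2_bump.
have in_ball t x : v x - b x < u t x -> sqdist y x < r ^+ 2.
  move=> bu; rewrite ltNge; apply/negP => xr.
  have : b x <= 0 by rewrite /b pmulr_rle0 // bump_le0.
  by have := uv t x; lra.
have vK t x : v x - b x < u t x -> forall k, `|x k 0 - y k 0| <= r.
  move=> /in_ball/ltW xr k; rewrite -(@ler_pXn2r _ 2) ?nnegrE //.
  by rewrite real_normK ?num_real // (le_trans (sqdist_entry _ _ _)).
have vu0 : v x0 - b x0 < u t0 x0 by rewrite /b; lra.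
have d20 : 0 < delta / 2 by rewrite divr_gt0.
have [uc [ud _] _ _] := uC12.
have [t [x [vux ut L]]] := @approximate_touching R n A q (fun x => v x - b x) u y r M
  t0 x0 (delta / 2) As Ap (C2B vC2 bC2) (fun t => C12_C2 t uC12) uc ud uM vK vu0 d20.
have E1 := @nondiv_opB R n A q v b x vC2 bC2.
have E2 := @nondiv_opZ R n A q eta (bump y a r) x (C2_bump y a r).
have := H t x (in_ball _ _ vux).
have -> : (v x - u t x < eta * bump y a r x) by rewrite -[eta * _]/(b x); lra.
move=> /(_ isT).
move: L ut; rewrite /excess [X in X <= _ -> _]E1 [X in _ - X]E2; lra.
Qed.

(** The bump of height [m] is compared with [v - u]. On the small ball the known bound [m] already
    dominates it; between the two radii a large [a] makes it a strict subsolution that absorbs the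
    zero order term. *)
Lemma spreading (R : realType) (n : nat) (A : 'cV[R]_n -> 'M[R]_n)
    (q : 'cV[R]_n -> 'cV[R]_n) (v : 'cV[R]_n -> R) (u : R -> 'cV[R]_n -> R)
    (y : 'cV[R]_n) (r M g T C m rho : R) :
  (forall x, (A x)^T = A x) ->
  0 < g -> (forall x xi, g * dot xi xi <= dot xi (A x *m xi)) ->
  C2 v -> C12 u -> (forall t x, u t x <= M) -> (forall t x, u t x <= v x) ->
  0 < r -> 0 <= T -> 0 <= C ->
  (forall x, sqdist y x <= r ^+ 2 -> \tr (A x) - dot (q x) (x - y) <= T) ->
  (forall t x, sqdist y x < r ^+ 2 -> - (C * (v x - u t x)) <= excess A q v u t x) ->
  0 < m -> 0 < rho ->
  (forall t x, sqdist y x < rho ^+ 2 -> m <= v x - u t x) ->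
  exists2 m', 0 < m' & forall t x, sqdist y x <= r ^+ 2 / 2 -> m' <= v x - u t x.
Proof.
move=> As g0 gA vC2 uC12 uM uv r0 T0 C0 HT Hex m0 rho0 Hm.
(* Large enough that [a * (4 * g * rho ^+ 2)] exceeds [2 * T + C + 1]; together with [a >= 1] this
   gives [aE]. The part [C] of [C + 1] absorbs the zero order term, the part 1 provides the
   margin. *)
pose a := (2 * T + C + 1) / (4 * g * rho ^+ 2) + 1.
have grho : 0 < 4 * g * rho ^+ 2 by rewrite !mulr_gt0 // exprn_gt0.
have a1 : 1 <= a by rewrite /a lerDr divr_ge0 ?(ltW grho) //; lra.
have a0 : 0 < a by lra.
have aE : 2 * a * T - 4 * a ^+ 2 * (g * rho ^+ 2) <= - (C + 1).
  have : 2 * T + C + 1 <= a * (4 * g * rho ^+ 2).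
    rewrite /a [leRHS]mulrDl divfK ?gt_eqF // mul1r lerDl; exact: ltW.
  move=> /(ler_wpM2l (ltW a0)) H.
  have : (C + 1) * 1 <= (C + 1) * a by rewrite ler_wpM2l //; lra.
  have -> : 4 * a ^+ 2 * (g * rho ^+ 2) = a * (a * (4 * g * rho ^+ 2)) by ring.
  by move: H; rewrite mulrDr mulrDr; lra.
have Ap x xi := @pos_of_elliptic R n (A x) g g0 (gA x) xi.
(* Lower bound of the Gaussian on the ball of radius [r], which makes the margin [m * e] uniform. *)
pose e := expR (- a * r ^+ 2).
have e0 : 0 < e by exact: expR_gt0.
have above := @above_bump R n A q v u y a r M m (m * e) As Ap vC2 uC12 uM uv
  (ltW a0) (ltW r0) m0 (mulr_gt0 m0 e0).
have {above} above : forall t x, m * bump y a r x <= v x - u t x.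
  apply: above => t x xr small.
  have xrho : rho ^+ 2 <= sqdist y x.
    rewrite leNgt; apply/negP => /(Hm t).
    have : m * bump y a r x <= m * 1.
      by rewrite ler_wpM2l ?(ltW m0) // (le_trans (bump_le_gauss _ _ _ _)) // gauss_le1 // ltW.
    by rewrite mulr1; lra.
  have gge : e <= gauss y a x := gauss_ge (ltW a0) (ltW xr).
  have := @nondiv_op_bump_le R n A q y x a r g T (ltW a0) (HT x (ltW xr)) (gA x _).
  set L := nondiv_op A q _ _ => HL.
  have {}HL : L <= gauss y a x * - (C + 1).
    apply: le_trans HL _; rewrite ler_wpM2l ?expR_ge0 //.
    apply: le_trans aE; rewrite lerB // ler_wpM2l //.
      by rewrite mulr_ge0 // sqr_ge0.
    by rewrite ler_wpM2l // ltW.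
  have wg : v x - u t x <= m * gauss y a x.
    by apply: le_trans (ltW small) _; rewrite ler_wpM2l ?(ltW m0) // bump_le_gauss.
  apply: le_trans (Hex t x xr).
  have /(ler_wpM2l (ltW m0)) := HL.
  have /(ler_wpM2l (ltW m0)) := gge.
  have /(ler_wpM2l C0) := wg.
  rewrite !mulrN !mulrDr !mulr1; lra.
have [b b0 bhalf] := bump_half y a0 r0.
exists (m * b); first exact: mulr_gt0.
by move=> t x /bhalf bx; apply: le_trans (above t x); rewrite ler_wpM2l // ltW.
Qed.

(** A source of size [delta] wherever [v - u] is small supports a bump of small height: the operator
    sends the bump with [a = 1] to at most [2 * T], so no prior lower bound is required. *)
Lemma local_lower_bound (R : realType) (n : nat) (A : 'cV[R]_n -> 'M[R]_n)
    (q : 'cV[R]_n -> 'cV[R]_n) (v : 'cV[R]_n -> R) (u : R -> 'cV[R]_n -> R)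
    (y : 'cV[R]_n) (r M g T eta delta : R) :
  (forall x, (A x)^T = A x) ->
  0 < g -> (forall x xi, g * dot xi xi <= dot xi (A x *m xi)) ->
  C2 v -> C12 u -> (forall t x, u t x <= M) -> (forall t x, u t x <= v x) ->
  0 < r -> 0 <= T ->
  (forall x, sqdist y x <= r ^+ 2 -> \tr (A x) - dot (q x) (x - y) <= T) ->
  0 < eta -> 0 < delta ->
  (forall t x, sqdist y x < r ^+ 2 -> v x - u t x < eta ->
     delta <= excess A q v u t x) ->
  exists2 m, 0 < m & forall t x, sqdist y x <= r ^+ 2 / 2 -> m <= v x - u t x.
Proof.
move=> As g0 gA vC2 uC12 uM uv r0 T0 HT eta0 delta0 Hex.
(* Ensures [2 * T * eta' + delta / 2 <= delta]; the summand 4 keeps the divisor positive when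
   [T = 0]. *)
pose eta' := Num.min eta (delta / (4 * T + 4)).
have T4 : 0 < 4 * T + 4 by lra.
have eta'0 : 0 < eta' by rewrite lt_min eta0 divr_gt0.
have eta'T : eta' * (4 * T + 4) <= delta.
  by rewrite -ler_pdivlMr // ge_min lexx orbT.
have Ap x xi := @pos_of_elliptic R n (A x) g g0 (gA x) xi.
have d20 : 0 < delta / 2 by rewrite divr_gt0.
have above := @above_bump R n A q v u y 1 r M eta' (delta / 2) As Ap vC2 uC12 uM uv
  ler01 (ltW r0) eta'0 d20.
have {above} above : forall t x, eta' * bump y 1 r x <= v x - u t x.
  apply: above => t x xr small.
  have b1 : bump y 1 r x <= 1.
    by rewrite (le_trans (bump_le_gauss _ _ _ _)) // gauss_le1.
  have /(Hex t x xr) : v x - u t x < eta.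
    apply: lt_le_trans small _; apply: (@le_trans _ _ (eta' * 1)).
      by rewrite ler_wpM2l // ltW.
    by rewrite mulr1 ge_min lexx.
  apply: le_trans.
  have := @nondiv_op_bump_le R n A q y x 1 r g T ler01 (HT x (ltW xr)) (gA x _).
  set L := nondiv_op A q _ _ => HL.
  have {}HL : L <= 2 * T.
    apply: le_trans HL _; apply: (@le_trans _ _ (gauss y 1 x * (2 * T))).
      rewrite ler_wpM2l ?expR_ge0 // mulr1 gerBl expr1n mulr1.
      by rewrite !mulr_ge0 ?sqdist_ge0 // ltW.
    by rewrite -[leRHS]mul1r ler_wpM2r ?gauss_le1 //; lra.
  have /(ler_wpM2l (ltW eta'0)) := HL.
  by move: eta'T; lra.
have [b b0 bhalf] := bump_half y ltr01 r0.
exists (eta' * b); first exact: mulr_gt0.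
by move=> t x /bhalf bx; apply: le_trans (above t x); rewrite ler_wpM2l // ltW.
Qed.

(** * Reduction to nondivergence form *)

(** Expanding the divergence by the product rule moves the first derivatives of [A] into the first
    order coefficient. *)
Definition drift (R : realType) (n : nat) (form : op_form) (A : 'cV[R]_n -> 'M[R]_n)
    (q : 'cV[R]_n -> 'cV[R]_n) (x : 'cV[R]_n) : 'cV[R]_n :=
  match form with
  | DivergenceForm => q x - \col_l \sum_k partial k A x k l
  | NondivergenceForm => q x
  end.

Lemma scalar_op_nondiv (R : realType) (n : nat) (form : op_form)
    (A : 'cV[R]_n -> 'M[R]_n) (q : 'cV[R]_n -> 'cV[R]_n) (psi : 'cV[R]_n -> R)
    (x : 'cV[R]_n) :
  (forall x, (A x)^T = A x) -> (forall k x, partial_exists k A x) -> C2 psi ->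
  scalar_op form A q psi x = nondiv_op A (drift form A q) psi x.
Proof.
move=> As Ap [pc pp ppc ppp pppc]; case: form => //=; rewrite /scalar_op /nondiv_op /drift.
have E k : partial k (fun y => (A y *m grad psi y) k 0) x =
    \sum_l (A x k l * partial k (partial l psi) x + partial l psi x * partial k A x k l).
  have -> : (fun y => (A y *m grad psi y) k 0) =
      \sum_l ((fun y => A y k l) * partial l psi).
    by apply/funext => y; rewrite mxE fct_sumE; apply: eq_bigr => l _; rewrite mxE.
  rewrite /partial derive_sum => [|l]; last first.
    by apply: derivableM; [exact: (partial_exists_entry (Ap k x))|exact: ppp].
  apply: eq_bigr => l _.
  rewrite deriveM; [|exact: (partial_exists_entry (Ap k x))|exact: ppp].
  by have := partial_entry k l (Ap k x); rewrite /partial => ->.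
rewrite /divergence; under eq_bigr => k _ do rewrite E big_split /=.
rewrite big_split /= opprD -addrA; congr (- _ + _).
  rewrite mxtrace_mulE exchange_big; apply: eq_bigr => k _; apply: eq_bigr => l _.
  by rewrite hess_entry -[in LHS](As x) mxE.
rewrite !dotE exchange_big -sumrN -big_split; apply: eq_bigr => l _ /=.
rewrite !mxE mulrBl mulr_suml addrC; congr (_ - _).
by apply: eq_bigr => k _; rewrite mulrC.
Qed.

Lemma Calpha_bounded (R : realType) (n : nat) (W : normedModType R) (a : R)
    (h : 'cV[R]_n -> W) (y : 'cV[R]_n) (r : R) :
  0 < a -> Calpha a h -> exists B, forall x, `|x - y| <= r -> `|h x| <= B.
Proof.
(* A Hölder constant carries no sign, hence its absolute value. *)
move=> a0 [C hC]; exists (`|h y| + `|C| * r `^ a) => x xr.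
have := ler_normD (h x - h y) (h y); rewrite subrK => /le_trans; apply.
rewrite addrC lerD2l; apply: le_trans (hC x y I I) _.
apply: (@le_trans _ _ (`|C| * `|x - y| `^ a)).
  by rewrite ler_wpM2r ?powR_ge0 // ler_norm.
rewrite ler_wpM2l // ge0_ler_powR ?nnegrE // ?(ltW a0) //.
exact: le_trans (normr_ge0 _) xr.
Qed.

Lemma norm_entry (R : realType) (m n : nat) (M : 'M[R]_(m, n)) i j : `|M i j| <= `|M|.
Proof. by rewrite [leRHS]/Num.Def.normr /= mx_normrE; apply: (le_bigmax _ _ (i, j)). Qed.

Lemma drift_bounded (R : realType) (n : nat) (form : op_form) (A : 'cV[R]_n -> 'M[R]_n)
    (q : 'cV[R]_n -> 'cV[R]_n) (alpha : R) (y : 'cV[R]_n) (r : R) :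
  0 < alpha -> C1alpha alpha A -> Calpha alpha q ->
  exists B, forall x l, `|x - y| <= r -> `|drift form A q x l 0| <= B.
Proof.
move=> a0 AC qC.
have [Bq HBq] := Calpha_bounded y r a0 qC.
have [BA HBA] : exists BA : 'I_n -> R, forall k x, `|x - y| <= r -> `|partial k A x| <= BA k.
  have /choice[BA HBA] : forall k, exists b, forall x, `|x - y| <= r -> `|partial k A x| <= b.
    by move=> k; have [_ Ck] := AC k; exact: Calpha_bounded a0 Ck.
  by exists BA.
exists (Bq + \sum_k BA k) => x l xr.
have S0 : 0 <= \sum_k BA k.
  by apply: sumr_ge0 => k _; apply: le_trans (normr_ge0 _) (HBA k x xr).
have ql : `|q x l 0| <= Bq := le_trans (norm_entry _ _ _) (HBq x xr).
case: form => /=; last by apply: le_trans ql _; rewrite lerDl.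
rewrite !mxE; apply: le_trans (ler_normB _ _) _; apply: lerD => //.
apply: le_trans (ler_norm_sum _ _ _) _; apply: ler_sum => k _.
exact: le_trans (norm_entry _ _ _) (HBA k x xr).
Qed.

(** Diagonal entries of [A] are values of its quadratic form at basis vectors, hence at most [g];
    the drift and [x - y] are bounded entrywise on the ball. *)
Lemma first_order_bounded (R : realType) (n : nat) (form : op_form)
    (A : 'cV[R]_n -> 'M[R]_n) (q : 'cV[R]_n -> 'cV[R]_n) (alpha g : R)
    (y : 'cV[R]_n) (r : R) :
  0 < alpha -> C1alpha alpha A -> Calpha alpha q -> 0 <= r ->
  (forall x xi, dot xi (A x *m xi) <= g * dot xi xi) ->
  exists2 T, 0 <= T & forall x, sqdist y x <= r ^+ 2 ->
    \tr (A x) - dot (drift form A q x) (x - y) <= T.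
Proof.
move=> a0 AC qC r0 Ag.
have [B HB] := @drift_bounded R n form A q alpha y r a0 AC qC.
exists (`|g *+ n + (`|B| * r) *+ n|) => // x xr; apply: le_trans (ler_norm _).
have xyr := sqdist_norm r0 xr.
apply: lerD.
  rewrite /mxtrace -[in leRHS](card_ord n) -sumr_const; apply: ler_sum => k _.
  have dd : dot (delta_mx k 0 : 'cV[R]_n) (delta_mx k 0) = 1.
    rewrite dotE (bigD1 k) //= !mxE !eqxx mulr1 big1 ?addr0 // => l lk.
    by rewrite !mxE (negbTE lk) mul0r.
  have := Ag x (delta_mx k 0); rewrite dd mulr1; apply: le_trans.
  rewrite quad_formE (bigD1 k) //= [X in X + _](bigD1 k) //= !mxE !eqxx !mul1r.
  rewrite [X in _ + X + _]big1 => [|l lk]; last by rewrite !mxE (negbTE lk) mulr0 mul0r.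
  by rewrite addr0 big1 ?addr0 // => l lk; rewrite big1 // => j _; rewrite mxE (negbTE lk) !mul0r.
rewrite dotE -sumrN -[in leRHS](card_ord n) -sumr_const; apply: ler_sum => k _.
apply: le_trans (ler_norm _) _; rewrite normrN normrM ler_pM //.
  exact: le_trans (HB x k xyr) (ler_norm _).
exact: le_trans (norm_entry _ _ _) xyr.
Qed.

(** * Systems and periodicity *)

Lemma C2_entry (R : realType) (n d : nat) (g : 'cV[R]_n -> 'cV[R]_d) (i : 'I_d) :
  C2 g -> C2 (fun x => g x i 0).
Proof.
move=> [gc gp gpc gpp gppc].
have E l : partial l (fun x => g x i 0) = (fun x => partial l g x i 0).
  by apply/funext => x; exact: partial_entry (gp l x).
have E2 k l : partial k (partial l (fun x => g x i 0)) =
    (fun x => partial k (partial l g) x i 0).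
  by apply/funext => x; rewrite E; exact: partial_entry (gpp k l x).
have ent (h : 'cV[R]_n -> 'cV[R]_d) : continuous h -> continuous (fun x => h x i 0).
  move=> hc x; exact: (continuous_comp (hc x) (@coord_continuous _ _ _ i 0 (h x))).
split.
- exact: ent.
- by move=> k x; exact: partial_exists_entry (gp k x).
- by move=> k; rewrite E; exact: ent.
- by move=> k l x; rewrite E; exact: partial_exists_entry (gpp k l x).
- by move=> k l; rewrite E2; exact: ent.
Qed.

Lemma derive1_entry (R : realType) (d : nat) (g : R -> 'cV[R]_d) (i : 'I_d) t :
  derivable g t 1 -> derive1 (fun s => g s i 0) t = derive1 g t i 0.
Proof. by move=> gt; rewrite !derive1E derive_mx // mxE. Qed.

Lemma C12_entry (R : realType) (n d : nat) (u : R -> 'cV[R]_n -> 'cV[R]_d) (i : 'I_d) :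
  C12 u -> C12 (fun t x => u t x i 0).
Proof.
move=> [uc [ud udc] up upp].
have Et : (fun p : R * 'cV[R]_n => derive1 (fun t => u t p.2 i 0) p.1) =
    (fun p => derive1 (u ^~ p.2) p.1 i 0).
  by apply/funext => -[t x]; exact: derive1_entry (ud t x).
have E t l : partial l (fun x => u t x i 0) = (fun x => partial l (u t) x i 0).
  by apply/funext => x; exact: partial_entry ((up l).1 t x).
have E2 k l : (fun p : R * 'cV[R]_n => partial k (partial l (fun x => u p.1 x i 0)) p.2) =
    (fun p => partial k (partial l (u p.1)) p.2 i 0).
  by apply/funext => -[t x]; rewrite E; exact: partial_entry ((upp k l).1 t x).
have ent (h : R * 'cV[R]_n -> 'cV[R]_d) : continuous h -> continuous (fun p => h p i 0).
  move=> hc p; exact: (continuous_comp (hc p) (@coord_continuous _ _ _ i 0 (h p))).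
split.
- exact: (ent _ uc).
- split; last by rewrite Et; exact: (ent _ udc).
  by move=> t x; have /derivable_mxP := ud t x; exact.
- move=> k; have [uk ukc] := up k; split.
    by move=> t x; exact: partial_exists_entry (uk t x).
  have -> : (fun p : R * 'cV[R]_n => partial k (fun x => u p.1 x i 0) p.2) =
      (fun p => partial k (u p.1) p.2 i 0) by apply/funext => p; rewrite E.
  exact: (ent _ ukc).
- move=> k l; have [ukl uklc] := upp k l; split; last by rewrite E2; exact: (ent _ uklc).
  by move=> t x; rewrite E; exact: partial_exists_entry (ukl t x).
Qed.

Lemma min_pos (R : realType) (d : nat) (p : 'I_d -> R) :
  (forall i, 0 < p i) -> exists2 m, 0 < m & forall i, m <= p i.
Proof.
(* The default value 1 keeps the minimum positive even over an empty index set. *)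
move=> p0; exists (\big[Num.min/1]_i p i); last by move=> i; exact: bigmin_le.
by elim/big_ind: _ => // [a b a0 b0]; rewrite lt_min a0.
Qed.

(** Subtracting the floors of the entries of [x - y] brings [x] into the unit cube with corner [y],
    whose squared diagonal is [n]. *)
Lemma integer_translate (R : realType) (n : nat) (x y : 'cV[R]_n) :
  exists k : 'cV[int]_n, (forall l, 0 <= (x - map_mx intr k) l 0 - y l 0 <= 1) /\
    sqdist y (x - map_mx intr k) <= n%:R.
Proof.
exists (\col_l Num.floor (x l 0 - y l 0)).
have H l : 0 <= (x - map_mx intr (\col_l Num.floor (x l 0 - y l 0))) l 0 - y l 0 <= 1.
  rewrite !mxE addrAC subr_ge0 lerBlDl; have /andP[-> /ltW] := floor_itv (x l 0 - y l 0).
  by rewrite intrD.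
split=> //; rewrite sqdistE -[leRHS](_ : \sum_(l < n) 1 = _); last first.
  by rewrite sumr_const card_ord.
apply: ler_sum => l _; have /andP[a b] := H l.
by rewrite expr2 mulr_ile1.
Qed.

(** Integer translations bring every point into one compact cube, where the extreme values are
    attained. *)
Lemma periodic_bounds (R : realType) (n : nat) (g : 'cV[R]_n -> R) :
  continuous g -> Zperiodic g ->
  exists x0 x1, forall x, g x0 <= g x <= g x1.
Proof.
move=> gc gper.
have Kc := @compact_cube R n 0 1.
have K0 : [set x : 'cV[R]_n | forall k, `|x k 0 - (0 : 'cV[R]_n) k 0| <= 1] 0.
  by move=> k; rewrite subrr normr0.
have [x0 _ H0] := compact_EVT_min (ex_intro _ _ K0) Kc (continuous_subspaceT gc).
have [x1 _ H1] := compact_EVT_max (ex_intro _ _ K0) Kc (continuous_subspaceT gc).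
exists x0, x1 => x.
have [k [Hk _]] := integer_translate x 0.
have -> : g x = g (x - map_mx intr k) by rewrite -[RHS](gper k) subrK.
by apply/andP; split; [apply: H0|apply: H1]; rewrite inE => l;
  have /andP[a b] := Hk l; rewrite ger0_norm.
Qed.

Lemma bounded_near (R : realType) (n : nat) (g : 'cV[R]_n -> R) (y : 'cV[R]_n) (r : R) :
  continuous g -> exists2 C, 0 <= C & forall x, sqdist y x <= r ^+ 2 -> - C <= g x.
Proof.
move=> gc.
have Kc := @compact_cube R n y `|r|.
have K0 : [set x : 'cV[R]_n | forall k, `|x k 0 - y k 0| <= `|r|] y.
  by move=> k; rewrite subrr normr0.
have [x0 _ H0] := compact_EVT_min (ex_intro _ _ K0) Kc (continuous_subspaceT gc).
exists `|g x0| => // x xr.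
have /le_trans -> // : - `|g x0| <= g x0 by rewrite lerNl -normrN ler_norm.
apply: H0; rewrite inE => k; rewrite -(@ler_pXn2r _ 2) ?nnegrE //.
by rewrite !real_normK ?num_real // (le_trans (sqdist_entry _ _ _)).
Qed.

Lemma sqdist_near (R : realType) (n : nat) (y : 'cV[R]_n) (P : set 'cV[R]_n) :
  (\forall x \near y, P x) ->
  exists2 r, 0 < r & forall x, sqdist y x < r ^+ 2 -> P x.
Proof.
(* Halving the radius turns the weak bound of [sqdist_norm] into the strict one defining a ball. *)
move=> /nbhs_ballP[r /= r0 Hr]; exists (r / 2); first by rewrite divr_gt0.
move=> x xr; apply: Hr; rewrite mx_norm_ball /ball_ /= -normrN opprB.
apply: (@le_lt_trans _ _ (r / 2)); last by rewrite ltr_pdivrMr // ltr_pMr // ltr1n.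
by apply: sqdist_norm; rewrite ?ltW // divr_gt0.
Qed.

(* The off-diagonal derivatives are nonnegative on the orthant, so only the
   [i]-th argument of [f_i] has to be kept. *)
Lemma cooperative_le (R : realType) (N d : nat)
    (f : 'cV[R]_N -> 'cV[R]_d -> 'cV[R]_d) (x : 'cV[R]_N) (u v : 'cV[R]_d) (i : 'I_d) :
  condN2 f -> (forall x u i j, partial_exists j (fun v => f x v i 0) u) ->
  lev 0 u -> lev u v -> u i 0 = v i 0 -> f x u i 0 <= f x v i 0.
Proof.
move=> [Sig [Sig0 coop]] fp u0 uv uvi.
have [xi xiE E] := @mean_value_partial R d (fun v => f x v i 0) u (v - u) (fun k y => fp x y i k).
rewrite [u + _]addrC subrK in E; rewrite -subr_ge0 E; apply: sumr_ge0 => k _.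
have [->|ki] := eqVneq k i; first by rewrite !mxE uvi subrr mul0r.
apply: mulr_ge0; first by rewrite !mxE subr_ge0.
have := coop (x, xi k); rewrite /= => /(_ _ i k); rewrite eq_sym ki mxE; apply => //.
apply: Sig0 => l; have [th /andP[th0 th1] ->] := xiE k l.
rewrite mxE; have := u0 l; rewrite !mxE => ul0.
by rewrite addr_ge0 // mulr_ge0 // subr_ge0.
Qed.

Lemma diag_op_entry (R : realType) (N d : nat) (form : 'I_d -> op_form)
    (A : 'I_d -> 'cV[R]_N -> 'M[R]_N) (q : 'I_d -> 'cV[R]_N -> 'cV[R]_N)
    (psi : 'cV[R]_N -> 'cV[R]_d) x i :
  diag_op form A q psi x i 0
    = scalar_op (form i) (A i) (q i) (fun y => psi y i 0) x.
Proof. by rewrite mxE. Qed.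

(** * Comparison of a wave with multiples of the principal eigenfunction *)

Theorem theorem1p3 (R : realType) (N d : nat) (N_ge1 : (1 <= N)%N)
  (d_gt1 : (1 < d)%N) (alpha : R) (alpha_gt0 : 0 < alpha)
  (form : 'I_d -> op_form) (A : 'I_d -> 'cV[R]_N -> 'M[R]_N)
  (q : 'I_d -> 'cV[R]_N -> 'cV[R]_N)
  (f : 'cV[R]_N -> 'cV[R]_d -> 'cV[R]_d)
  (hC : condC alpha A q) (hN1 : condN1 alpha f) (hN2 : condN2 f)
  (hN3 : condN3 f) (hN4 : condN4 f)
  (lambda1p : R)
  (hlambda : periodic_principal_eigenvalue form A q f lambda1p)
  (lambda1p_ge0 : 0 <= lambda1p)
  (hKPP : forall (x : 'cV[R]_N) (u : 'cV[R]_d),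
     lev 0 u -> lev (f x u) (Du f x 0 *m u))
  (hKPP_strict : forall (x : 'cV[R]_N) (u : 'cV[R]_d),
     lltv 0 u -> ltv (f x u) (Du f x 0 *m u)) :
  forall e : 'cV[R]_N, dot e e = 1 ->
  forall c : R, c != 0 ->
  ~ exists u : R -> 'cV[R]_N -> 'cV[R]_d, pulsating_wave form A q f e c u.
Proof.
move=> e _ c _ [u [[uC12 [M uM] uE] upos upuls _ _]].
have [HA Hq [g [gmax [g0 _ Hell]]]] := hC.
have [_ [fcont _] [fp Ducont] _ _] := hN1.
have [phi [phiper phiC2 phipos _ phiE]] := hlambda.
have phi0 i x : 0 < phi x i 0 by have := phipos x i; rewrite mxE.
have u0 i t x : 0 < u t x i 0 by have := upos t x i; rewrite mxE.
have uM' i t x : u t x i 0 <= M.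
  exact: le_trans (le_trans (ler_norm _) (norm_entry _ _ _)) (uM t x).
pose h x i j := Du f x 0 i j.
have hcont i j : continuous (fun x => h x i j).
  move=> x; have c1 : {for x, continuous (fun x : 'cV[R]_N => (x, 0 : 'cV[R]_d))}.
    by apply: (@cvg_pair _ _ _ (nbhs x) (nbhs x) (nbhs (0 : 'cV[R]_d)));
      [exact: cvg_id|exact: cvg_cst].
  have c2 := continuous_comp c1 (Ducont (x, 0)).
  exact: (continuous_comp c2 (@coord_continuous _ _ _ i j (Du f x 0))).
have hcoop x i j : i != j -> 0 <= h x i j.
  have [Sig [Sig0 coop]] := hN2; apply: (coop (x, 0)).
  by apply: Sig0 => l.
pose phi_ i x := phi x i 0; pose u_ i t x := u t x i 0.
have phi_C2 i : C2 (phi_ i) := C2_entry i phiC2.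
have u_C12 i : C12 (u_ i) := C12_entry i uC12.
have phi_cont i : continuous (phi_ i) by case: (phi_C2 i).
have phi_per i : Zperiodic (phi_ i) by move=> k x; rewrite /phi_ phiper.
pose q' i := drift (form i) (A i) (q i).
have As i x : (A i x)^T = A i x by case: (HA i).
have Apart i k x : partial_exists k (A i) x by have [_ _ AC1] := HA i; case: (AC1 k).
have Aell i x xi : g * dot xi xi <= dot xi (A i x *m xi).
  by have /andP[] := Hell i x xi.
have Tbound i y r : 0 <= r -> exists2 T, 0 <= T & forall x, sqdist y x <= r ^+ 2 ->
    \tr (A i x) - dot (q' i x) (x - y) <= T.
  move=> r0; have [_ _ AC1] := HA i; have [_ qC] := Hq i.
  apply: (@first_order_bounded R N (form i) (A i) (q i) alpha gmax y r alpha_gt0 AC1 qC r0).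
  by move=> x xi; have /andP[] := Hell i x xi.
have mulE (B : 'M[R]_d) (a : 'cV[R]_d) i : (B *m a) i 0 = \sum_j B i j * a j 0.
  by rewrite mxE.
have Lphi i x : nondiv_op (A i) (q' i) (phi_ i) x =
    \sum_j h x i j * phi x j 0 + lambda1p * phi x i 0.
  rewrite -(scalar_op_nondiv (form i) (q i) x (As i) (Apart i) (phi_C2 i)).
  have := congr1 (fun m : 'cV[R]_d => m i 0) (phiE x).
  have -> (a b : 'cV[R]_d) : (a - b) i 0 = a i 0 - b i 0 by rewrite !mxE.
  have -> (s : R) (a : 'cV[R]_d) : (s *: a) i 0 = s * a i 0 by rewrite mxE.
  by rewrite diag_op_entry mulE => <-; rewrite addrC subrK.
have Lu i t x : derive1 (u_ i ^~ x) t + nondiv_op (A i) (q' i) (u_ i t) x = f x (u t x) i 0.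
  rewrite -(scalar_op_nondiv (form i) (q i) x (As i) (Apart i) (C12_C2 t (u_C12 i))).
  have addE (a b : 'cV[R]_d) : (a + b) i 0 = a i 0 + b i 0 by rewrite mxE.
  rewrite -uE addE diag_op_entry; congr (_ + _).
  by have [_ [ud _] _ _] := uC12; exact: derive1_entry (ud t x).
(* The two-sided bounds on [phi] come from positivity, continuity and periodicity: [lo] makes the
   quotients [u / phi] bounded, [hi] turns a lower bound on [w] into a decrease of [kap]. *)
have [lo [p0 plo]] : exists lo : R, 0 < lo /\ forall i x, lo <= phi x i 0.
  have /choice[x0 H] : forall i, exists x0, forall x, phi_ i x0 <= phi_ i x.
    move=> i; have [x0 [x1 H]] := periodic_bounds (phi_cont i) (phi_per i).
    by exists x0 => x; case/andP: (H x).
  have [lo lo0 Hlo] := min_pos (fun i => phi0 i (x0 i)).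
  by exists lo; split=> // i x; exact: le_trans (Hlo i) (H i x).
have [hi hi0 phi_hi] : exists2 hi : R, 0 < hi & forall i x, phi x i 0 <= hi.
  have /choice[x1 H] : forall i, exists x1, forall x, phi_ i x <= phi_ i x1.
    move=> i; have [x0 [x1 H]] := periodic_bounds (phi_cont i) (phi_per i).
    by exists x1 => x; case/andP: (H x).
  exists (1 + \sum_i phi (x1 i) i 0) => [|i x].
    by rewrite ltr_pwDl // sumr_ge0 // => i _; exact: ltW.
  apply: le_trans (H i x) _; rewrite (bigD1 i) //= addrCA lerDl addr_ge0 //.
  by rewrite sumr_ge0 // => j _; exact: ltW.
pose i0 := Ordinal (ltnW d_gt1).
(* Its supremum [kap] is the least number with [u <= kap * phi] in all components. *)
pose E := [set s : R | exists i t x, s = u t x i 0 / phi x i 0].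
have Esup : has_sup E.
  split; first by exists (u 0 0 i0 0 / phi 0 i0 0), i0, 0, 0.
  exists (M / lo) => _ [i [t [x ->]]].
  rewrite ler_pdivrMr // mulrAC ler_pdivlMr //.
  exact: ler_pM (ltW (u0 i t x)) (ltW p0) (uM' i t x) (plo i x).
pose kap := sup E.
have u_le i t x : u t x i 0 <= kap * phi x i 0.
  by rewrite -ler_pdivrMr //; apply: ub_le_sup; [exact: Esup.2|exists i, t, x].
have kap0 : 0 < kap.
  have := lt_le_trans (u0 i0 0 0) (u_le i0 0 0).
  by rewrite pmulr_lgt0.
pose v_ i x := kap * phi_ i x.
pose w i t x := v_ i x - u_ i t x.
have w_ge0 i t x : 0 <= w i t x by rewrite subr_ge0 u_le.
have v_C2 i : C2 (v_ i) by exact: C2Z.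
pose ex i := excess (A i) (q' i) (v_ i) (u_ i).
(* The discarded term [kap * lambda1p * phi] is nonnegative; this is where the sign of the
   eigenvalue enters. *)
have ex_ge i t x : kap * (\sum_j h x i j * phi x j 0) - f x (u t x) i 0 <= ex i t x.
  rewrite /ex /excess Lu (nondiv_opZ _ _ kap x (phi_C2 i)) Lphi lerB //.
  by rewrite ler_wpM2l ?(ltW kap0) // lerDl mulr_ge0 // ltW.
(* The weak KPP inequality replaces [f] by its linearisation at zero, which gives a linear
   differential inequality for [w]. *)
have ex_lin i t x : \sum_j h x i j * w j t x <= ex i t x.
  apply: le_trans (ex_ge i t x).
  have u0' : lev 0 (u t x) by move=> j; rewrite mxE ltW.
  have := hKPP x (u t x) u0' i; rewrite mulE => fle.
  rewrite (_ : \sum_j _ = kap * (\sum_j h x i j * phi x j 0) - \sum_j h x i j * u t x j 0).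
    by rewrite lerB.
  rewrite mulr_sumr -sumrB; apply: eq_bigr => j _.
  by rewrite /w /v_ /phi_ /u_; ring.
(* All other off-diagonal terms are nonnegative by cooperativity and [w >= 0]. *)
have ex_pair i j t x : i != j -> h x i i * w i t x + h x i j * w j t x <= ex i t x.
  move=> ij; apply: le_trans (ex_lin i t x).
  rewrite (bigD1 i) //= lerD2l (bigD1 j) 1?eq_sym //= lerDl sumr_ge0 // => l /andP[li _].
  by rewrite mulr_ge0 // hcoop // eq_sym.
have ex_diag i t x : h x i i * w i t x <= ex i t x.
  apply: le_trans (ex_lin i t x).
  rewrite (bigD1 i) //= lerDl sumr_ge0 // => l li.
  by rewrite mulr_ge0 // hcoop // eq_sym.
pose P i := exists2 m, 0 < m & forall t x, m <= w i t x.
have global i y rho m : 0 < rho -> 0 < m ->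
    (forall t x, sqdist y x < rho ^+ 2 -> m <= w i t x) -> P i.
  (* With [r = N + 1] one has [N <= r ^+ 2 / 2], so the ball reached by [spreading] contains a full
     unit cube of periodicity. *)
  move=> rho0 m0 Hm; pose r : R := N.+1%:R.
  have r0 : 0 < r by rewrite ltr0n.
  have [T T0 HT] := Tbound i y r (ltW r0).
  have [C C0 HC] := bounded_near y r (hcont i i).
  have Hex t x : sqdist y x < r ^+ 2 -> - (C * w i t x) <= ex i t x.
    move=> xr; apply: le_trans (ex_diag i t x).
    by rewrite -mulNr ler_wpM2r // HC // ltW.
  have [m' m'0 Hm'] := @spreading R N (A i) (q' i) (v_ i) (u_ i) y r M g T C m rho
    (As i) g0 (Aell i) (v_C2 i) (u_C12 i) (uM' i) (u_le i) r0 T0 C0 HT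
    Hex m0 rho0 Hm.
  exists m' => // t x.
  have [k [_ Hk]] := integer_translate x y.
  (* The pulsating relation trades an integer translation in space for a shift in time, which a
     bound uniform in time does not see. *)
  have -> : w i t x = w i (t - dot (map_mx intr k) e / c) (x - map_mx intr k).
    have := upuls k (t - dot (map_mx intr k) e / c) x; rewrite subrK => ux.
    rewrite /w /v_ /u_ ux -[phi_ i (x - _)](phi_per i k) subrK //.
  apply: Hm'; apply: le_trans Hk _.
  by rewrite /r -natr1 ler_pdivlMr //; have : (0 : R) <= N%:R by []; nra.
have local i y r eta delta : 0 < r -> 0 < eta -> 0 < delta ->
    (forall t x, sqdist y x < r ^+ 2 -> w i t x < eta -> delta <= ex i t x) -> P i.
  move=> r0 eta0 delta0 H.
  have [T T0 HT] := Tbound i y r (ltW r0).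
  have [m m0 Hm] := @local_lower_bound R N (A i) (q' i) (v_ i) (u_ i) y r M g T eta delta
    (As i) g0 (Aell i) (v_C2 i) (u_C12 i) (uM' i) (u_le i) r0 T0 HT eta0 delta0 H.
  apply: (@global i y (r / 2) m) => //; first by rewrite divr_gt0.
  move=> t x xr; apply: Hm; apply: le_trans (ltW xr) _.
  by have := sqr_ge0 r; nra.
(* A common lower bound [m0] on all [w i] would give [u <= (kap - m0 / hi) * phi], against the
   minimality of [kap]. *)
have nall : ~ forall i, P i.
  move=> HP.
  have /choice[m Hm] : forall i, exists m, 0 < m /\ forall t x, m <= w i t x.
    by move=> i; have [m ? ?] := HP i; exists m.
  have [m0 m00 Hm0] := min_pos (fun i => (Hm i).1).
  have : kap <= kap - m0 / hi.
    apply: ge_sup; first exact: Esup.1.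
    move=> _ [i [t [x ->]]]; rewrite ler_pdivrMr // mulrBl lerBrDr -lerBrDl.
    apply: le_trans (_ : m0 <= _).
      by rewrite mulrAC ler_pdivrMr // ler_wpM2l // ltW.
    exact: le_trans (Hm0 i) ((Hm i).2 t x).
  by rewrite lerBrDr gerDl leNgt divr_gt0.
have couple i j z : i != j -> h z i j != 0 -> P j -> P i.
  move=> ij hz [m m0 Hm].
  have hz0 : 0 < h z i j by rewrite lt_def hz hcoop.
  have [r r0 Hr] : exists2 r, 0 < r & forall x, sqdist z x < r ^+ 2 -> h z i j / 2 < h x i j.
    apply: (@sqdist_near R N z (fun x => h z i j / 2 < h x i j)).
    apply: (cvgr_gt (h z i j) (hcont i j z)).
    by rewrite ltr_pdivrMr // ltr_pMr // ltr1n.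
  have [C C0 HC] := bounded_near z r (hcont i i).
  pose h0 := h z i j / 2.
  have h00 : 0 < h0 by rewrite divr_gt0.
  (* Near [z] the coupling supplies at least [h0 * m]; below the chosen threshold [C * w] is at most
     half of it. The summand 1 keeps the divisor positive when [C = 0]. *)
  apply: (@local i z r (h0 * m / (2 * (C + 1))) (h0 * m / 2)) => //.
  - by rewrite !(mulr_gt0, invr_gt0) //; lra.
  - by rewrite !(mulr_gt0, invr_gt0).
  move=> t x xr; rewrite ltr_pdivlMr; last by lra.
  move=> wsmall; apply: le_trans (ex_pair i j t x ij).
  have H1 : - (C * w i t x) <= h x i i * w i t x.
    by rewrite -mulNr ler_wpM2r // HC // ltW.
  have H2 : h0 * m <= h x i j * w j t x.
    exact: ler_pM (ltW h00) (ltW m0) (ltW (Hr x xr)) (Hm t x).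
  have := w_ge0 i t x; lra.
(* The strict KPP inequality at [kap *: phi 0] singles out a component [i] which has a source near
   the origin whenever [w i] is small. *)
have start : exists i, P i.
  have kphi : lltv 0 (kap *: phi 0) by move=> i; rewrite !mxE mulr_gt0.
  have [_ [i Hi]] := hKPP_strict 0 _ kphi.
  exists i.
  pose S (x : 'cV[R]_N) := \sum_j h x i j * phi_ j x.
  pose F1 (p : 'cV[R]_N * R) := kap * S p.1.
  pose F2 (p : 'cV[R]_N * R) := kap *: phi p.1 - p.2 *: (delta_mx i 0 : 'cV[R]_d).
  (* [F (x, s)] is the linear term at [kap *: phi x] minus [f] at that vector lowered by [s] in
     entry [i]. It is positive at [(0, 0)], hence nearby, and [F (x, w i t x)] will bound the excess
     from below. *)
  pose F p := F1 p - f p.1 (F2 p) i 0.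
  have Fcont : continuous F.
    have phic : continuous phi by case: phiC2.
    have c1 (p : 'cV[R]_N * R) : {for p, continuous (fun p : 'cV[R]_N * R => p.1)}.
      exact: cvg_fst.
    have c2 (p : 'cV[R]_N * R) : {for p, continuous (fun p : 'cV[R]_N * R => p.2)}.
      exact: cvg_snd.
    have cS : continuous S.
      have cj j : continuous (fun x => h x i j * phi_ j x).
        by move=> x; exact: (continuousM (hcont i j x) (phi_cont j x)).
      by apply: (continuous_big (op := +%R)) => [|j _]; [exact: add_continuous|exact: cj].
    move=> p.
    have cF1 : {for p, continuous F1}.
      exact: (continuousM (@cst_continuous _ _ kap p) (continuous_comp (c1 p) (cS p.1))).
    have cF2 : {for p, continuous F2}.
      exact: (continuousB (continuousZ (@cst_continuous _ _ kap p)
        (continuous_comp (c1 p) (phic p.1))) (continuousZ (c2 p)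
        (@cst_continuous _ _ (delta_mx i 0 : 'cV[R]_d) p))).
    have cpair : {for p, continuous (fun p => (p.1, F2 p))}.
      exact: (@cvg_pair _ _ _ (nbhs p) (nbhs p.1) (nbhs (F2 p)) _ _ _ _ _ (c1 p) cF2).
    have cf := continuous_comp cpair (fcont (p.1, F2 p)).
    have cfi := continuous_comp cf (@coord_continuous _ _ _ i 0 (f p.1 (F2 p))).
    exact: (continuousB cF1 cfi).
  have F0 : 0 < F (0, 0).
    rewrite /F /F1 /F2 /= scale0r subr0 subr_gt0; apply: lt_le_trans Hi _.
    rewrite mulE mulr_sumr le_eqVlt; apply/orP; left; apply/eqP.
    apply: eq_bigr => j _; have -> (a : 'cV[R]_d) : (kap *: a) j 0 = kap * a j 0 by rewrite mxE.
    exact: mulrCA.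
  have : \forall p \near (0 : 'cV[R]_N, 0 : R), F (0, 0) / 2 < F p.
    apply: (cvgr_gt (F (0, 0)) (Fcont (0, 0))).
    by rewrite ltr_pdivrMr // ltr_pMr // ltr1n.
  move=> /nbhs_ballP[r /= r0 Hr].
  have r20 : 0 < r / 2 by rewrite divr_gt0.
  have r2r : r / 2 < r by rewrite ltr_pdivrMr // ltr_pMr // ltr1n.
  apply: (@local i 0 (r / 2) (r / 2) (F (0, 0) / 2)) => //; first by rewrite divr_gt0.
  move=> t x xr wr; apply: le_trans (ex_ge i t x).
  apply: le_trans (_ : F (x, w i t x) <= _).
    apply/ltW/Hr; split => /=.
      rewrite mx_norm_ball /ball_ /= -normrN opprB.
      by apply: le_lt_trans r2r; apply: sqdist_norm (ltW xr); exact: ltW.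
    by rewrite /ball /= sub0r normrN ger0_norm // (lt_trans wr).
  have F2E j : F2 (x, w i t x) j 0 = kap * phi x j 0 - w i t x * (j == i)%:R.
    by rewrite /F2 !mxE andbT.
  have wE : kap * phi x i 0 - w i t x = u t x i 0 by rewrite /w /v_ /phi_ /u_; ring.
  (* Lowering only entry [i] by [w i t x] gives a vector above [u t x] with the same entry [i], so
     cooperativity compares the values of [f] in component [i]. *)
  rewrite /F /F1 /= lerB //; apply: (@cooperative_le R N d f x) => //.
  - by move=> j; rewrite mxE ltW.
  - move=> j; rewrite F2E; have [->|ji] := eqVneq j i.
      by rewrite mulr1 wE.
    by rewrite mulr0 subr0 u_le.
  - by rewrite F2E eqxx mulr1 wE.
have [i Pi] := start.
(* Full coupling at [u = 0] is applied to the complement of [I] and [I], nonempty by [nall] and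
   [start]. It yields a coupling from a component in [I] to one outside, which [couple] then puts
   into [I]. *)
pose I := finset.finset (fun j => `[< P j >]).
have IP j : reflect (P j) (j \in I) by rewrite finset.in_set; exact: asboolP.
have [||||j [l [Hj Hl [z hz]]]] := @hN4 0 (~: I)%SET I.
- apply/eqP => /finset.setP I0; apply: nall => j; apply/IP.
  by have := I0 j; rewrite finset.in_setC finset.in_set0 => /negbFE.
- apply/eqP => /finset.setP/(_ i); rewrite finset.in_set0 => /negP; apply.
  exact/IP.
- by rewrite finset.setIC finset.setICr.
- by rewrite finset.setUC finset.setUCr.
rewrite finset.in_setC in Hj; move/IP: (Hl) => Pl.
apply/(negP Hj)/IP; apply: (couple j l z) => //.
by apply: contraNneq Hj => ->.
Qed.
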